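(* Let $(M,L)$ be a Finsler manifold admitting a concurrent $\pi$-vector field $\overline{\zeta}$, and let $(M,\widetilde{L})$ be the Finsler manifold obtained from it by the energy $\beta$-change $\widetilde{L}^{2}=L^{2}+B^{2}$, where $B:=g(\overline{\zeta},\overline{\eta})$. Put $p^{2}:=g(\overline{\zeta},\overline{\zeta})$ and $E:=\frac12 L^2$. Then the associated Barthel connections $\Gamma$ (of $L$) and $\widetilde{\Gamma}$ (of $\widetilde{L}$) are related by $$\widetilde{\Gamma}=\Gamma+2\,\frac{d_{J}E}{1+p^{2}}\otimes\gamma\overline{\zeta}.$$
   Context: $M$ is a real paracompact smooth manifold of finite dimension $n$; all objects are $C^\infty$. $\pi:\mathcal{T}M\to M$ is the bundle of nonzero tangent vectors, $\pi^{-1}(TM)\to\mathcal{T}M$ the pullback of $TM$ by $\pi$. Sections of $\pi^{-1}(TM)$ are called $\pi$-vector fields, are written with bars, and form the module $\mathfrak{X}(\pi(M))$. The fundamental $\pi$-vector field is $\overline{\eta}(u)=(u,u)$. $\rho:T(\mathcal{T}M)\to\pi^{-1}(TM)$ is $\rho=(\pi_{\mathcal{T}M},d\pi)$, and $\gamma:\pi^{-1}(TM)\to T(\mathcal{T}M)$ is the vertical lift $\gamma(u,v)=j_u(v)$, with $j_u:T_{\pi(u)}M\to T_u(T_{\pi(u)}M)$ the natural isomorphism. $J:=\gamma\circ\rho$ is the natural almost tangent structure. $(M,L)$ is a Finsler manifold with Finsler metric $g$ on $\pi^{-1}(TM)$ (locally $g_{ij}=\frac12\partial^2L^2/\partial y^i\partial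 y^j$). For a linear connection $D$ on $\pi^{-1}(TM)$ its connection map is $K(X)=D_X\overline{\eta}$; $D$ is regular if $T_u(\mathcal{T}M)=V_u(\mathcal{T}M)\oplus\ker K_u$ for all $u$ ($V$ the vertical bundle), and then its horizontal map is $\beta:=(\rho|_{\ker K})^{-1}$. With torsion $\mathbf{T}(X,Y)=D_X\rho Y-D_Y\rho X-\rho[X,Y]$, put $Q(\overline{X},\overline{Y})=\mathbf{T}(\beta\overline{X},\beta\overline{Y})$ and $T(\overline{X},\overline{Y})=\mathbf{T}(\gamma\overline{X},\beta\overline{Y})$. The Cartan connection $\nabla$ is the unique regular connection on $\pi^{-1}(TM)$ with $\nabla g=0$, $Q=0$ and $g(T(\overline{X},\overline{Y}),\overline{Z})=g(T(\overline{X},\overline{Z}),\overline{Y})$. A $\pi$-vector field $\overline{\zeta}$ is concurrent if $\nabla_{\beta\overline{X}}\overline{\zeta}=-\overline{X}$ and $\nabla_{\gamma\overline{X}}\overline{\zeta}=0$ for all $\overline{X}$. For a function $f$, $d_Jf:=df\circ J$. The canonical spray $G$ of $(M,L)$ is the vector field defined by $i_G\Omega=-dE$, where $E=\frac12L^2$ and $\Omega=dd_JE$. The Barthel connection of $(M,L)$ is the vector $1$-form (nonlinear connection) $\Gamma=[J,G]$, i.e. $\Gamma X=[JX,G]-J[X,G]$; $\widetilde{\Gamma}$ is the same object for $\widetilde{L}$. For a $1$-form $\omega$ and vector field $V$, $(\omega\otimes V)(X)=\omega(X)V$. *)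

(* Defs.v *)
From HB Require Import structures.
From mathcomp Require Import all_boot all_order all_algebra.
From mathcomp Require Import all_classical all_reals all_analysis.

Set Implicit Arguments.
Unset Strict Implicit.
Unset Printing Implicit Defensive.

Import Order.TTheory GRing.Theory Num.Theory.
Import numFieldNormedType.Exports.

Local Open Scope classical_set_scope.
Local Open Scope ring_scope.

(* Only ever used between finite-dimensional spaces, where the existence and
   continuity of all iterated directional derivatives is the usual C^k. *)
Fixpoint class_C (R : realType) (V W : normedModType R) (k : nat)
    (O : set V) (f : V -> W) : Prop :=
  match k with
  | 0 => forall x, O x -> {for x, continuous f}
  | k'.+1 => (forall x v, O x -> derivable f x v) /\
             (forall v, class_C k' O ('D_v f))
  end.

Definition smooth_near (R : realType) (V W : normedModType R)
    (f : V -> W) (x : V) : Prop :=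
  exists2 O, open_nbhs x O & forall k, class_C k O f.

Definition paracompact (T : topologicalType) : Prop :=
  forall U : set (set T),
    (forall A, U A -> open A) -> \bigcup_(A in U) A = setT ->
  exists F : set (set T),
    [/\ forall A, F A -> open A,
        \bigcup_(A in F) A = setT,
        forall A, F A -> exists2 B, U B & A `<=` B
      & forall x : T, exists2 N, nbhs x N & finite_set [set A | F A /\ A `&` N !=set0]].

(* Charts [chart i : dom i -> V] with inverses [param i], both extended by
   arbitrary values to total functions, and a preferred chart around each
   point.  The tangent space at x is V itself: a tangent vector is given by its
   components in the chart [chart_at x]. *)
Record atlas (R : realType) (V : normedModType R) (X : Type) := Atlas {
  index : Type;
  dom : index -> set X;
  chart : index -> X -> V;
  param : index -> V -> X;
  chart_at : X -> index }.

Arguments dom {R V X} a i _.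
Arguments chart {R V X} a i _.
Arguments param {R V X} a i _.
Arguments chart_at {R V X} a x.

Record manifold (R : realType) (n : nat) := Manifold {
  carrier :> topologicalType;
  matlas : atlas 'rV[R]_n carrier;
  manifold_hausdorff : hausdorff_space carrier;
  manifold_paracompact : paracompact carrier;
  dom_chart_at : forall x, dom matlas (chart_at matlas x) x;
  dom_open : forall i, open (dom matlas i);
  chart_open : forall i, open (chart matlas i @` dom matlas i);
  chartK : forall i, {in dom matlas i, cancel (chart matlas i) (param matlas i)};
  chart_continuous : forall i x, dom matlas i x -> {for x, continuous (chart matlas i)};
  param_continuous : forall i x, dom matlas i x ->
    {for chart matlas i x, continuous (param matlas i)};
  transition_smooth : forall i j x, dom matlas i x -> dom matlas j x ->
    smooth_near (chart matlas j \o param matlas i) (chart matlas i x) }.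

Section Atlas.
Context (R : realType) (V : normedModType R) (X : Type) (A : atlas V X).

(* the preferred chart at x, evaluated at x *)
Definition coord (x : X) : V := chart A (chart_at A x) x.

(* components in chart i of the tangent vector v at x *)
Definition components (i : index A) (x : X) (v : V) : V :=
  'D_v (chart A i \o param A (chart_at A x)) (coord x).

Definition fun_smooth_at (W : normedModType R) (f : X -> W) (x : X) : Prop :=
  smooth_near (f \o param A (chart_at A x)) (coord x).

Definition differential (f : X -> R^o) (x : X) (v : V) : R :=
  'D_v (f \o param A (chart_at A x)) (coord x).

Definition vf_local (i : index A) (Z : X -> V) (z : V) : V :=
  components i (param A i z) (Z (param A i z)).

Definition vf_smooth_at (Z : X -> V) (x : X) : Prop :=
  smooth_near (vf_local (chart_at A x) Z) (coord x).

Definition lie_bracket (Y Z : X -> V) (x : X) : V :=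
  let i := chart_at A x in
  'D_(Y x) (vf_local i Z) (coord x) - 'D_(Z x) (vf_local i Y) (coord x).

Definition ext_deriv (w : X -> V -> R) (Y Z : X -> V) (x : X) : R :=
  differential (fun x' => w x' (Z x')) x (Y x)
  - differential (fun x' => w x' (Y x')) x (Z x)
  - w x (lie_bracket Y Z x).

Definition tangent_atlas : atlas (V * V)%type (X * V)%type := {|
  index := index A;
  dom := fun i => [set u | dom A i u.1];
  chart := fun i u => (chart A i u.1, components i u.1 u.2);
  param := fun i z =>
    let x := param A i z.1 in
    (x, 'D_(z.2) (chart A (chart_at A x) \o param A i) z.1);
  chart_at := fun u => chart_at A u.1 |}.

End Atlas.

Definition tangent_map (R : realType) (V W : normedModType R) (X Y : Type)
    (A : atlas V X) (B : atlas W Y) (F : X -> Y) (x : X) (v : V) : W :=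
  'D_v (chart B (chart_at B (F x)) \o F \o param A (chart_at A x)) (coord A x).

Section Pullback.
Context (R : realType) (n : nat) (M : manifold R n).

Let V := 'rV[R]_n.
Let A := matlas M.

(* Mind that the product topology of M * V is not the one of the tangent
   bundle (the components of a vector at x refer to [chart_at x]); everything
   below goes through [tangent_atlas]. *)
Definition TM : Type := (carrier M * V)%type.
Definition TA : atlas (V * V)%type TM := tangent_atlas A.

(* Nonzero tangent vectors.  Objects living on this open subset are total
   functions on TM whose values elsewhere are irrelevant. *)
Definition slit : set TM := [set u | u.2 != 0].

(* u |-> X u in T_u(TM), and u |-> xi u in T_(pi u) M *)
Definition vfield : Type := TM -> (V * V)%type.
Definition pi_vfield : Type := TM -> V.

Definition pi_smooth_at (xi : pi_vfield) (u : TM) : Prop :=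
  smooth_near
    (fun z => let u' := param TA (chart_at TA u) z in
              components (A := A) (chart_at A u.1) u'.1 (xi u'))
    (coord TA u).

Definition eta : pi_vfield := fun u => u.2.

Definition rho (u : TM) (w : V * V) : V := tangent_map TA A fst u w.

Definition gamma (u : TM) (v : V) : V * V :=
  'D_v (fun y => chart TA (chart_at TA u) (u.1, y)) u.2.

Definition J (u : TM) (w : V * V) : V * V := gamma u (rho u w).

Definition energy (L : TM -> R) (u : TM) : R := L u ^+ 2 / 2.

(* Half the second derivative of L^2 along the fibre, i.e. the bilinear form
   with matrix g_ij = 1/2 d^2 L^2 / dy^i dy^j. *)
Definition metric (L : TM -> R) (u : TM) (v w : V) : R :=
  'D_v ('D_w (fun y => L (u.1, y) ^+ 2 : R^o)) u.2 / 2.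

Record finsler (L : TM -> R) : Prop := {
  finsler_pos : forall u, slit u -> 0 < L u;
  finsler_homogeneous : forall x y l, 0 <= l -> L (x, l *: y) = l * L (x, y);
  finsler_smooth : forall u, slit u -> fun_smooth_at TA (L : TM -> R^o) u;
  finsler_convex : forall u v, slit u -> v != 0 -> 0 < metric L u v v }.

(* [D u w xi] is the value at u of D_w xi, for w in T_u(TM).  Sections are
   taken in a neighbourhood of u, so that D operates on germs; every connection
   on global sections extends uniquely to local ones. *)
Definition covariant_derivative : Type := TM -> (V * V)%type -> pi_vfield -> V.

Record linear_connection (D : covariant_derivative) : Prop := {
  connection_linear : forall u a w w' xi, slit u -> pi_smooth_at xi u ->
    D u (a *: w + w') xi = a *: D u w xi + D u w' xi;
  connection_additive : forall u w xi psi, slit u ->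
    pi_smooth_at xi u -> pi_smooth_at psi u ->
    D u w (fun u' => xi u' + psi u') = D u w xi + D u w psi;
  connection_leibniz : forall u w (f : TM -> R^o) xi, slit u ->
    fun_smooth_at TA f u -> pi_smooth_at xi u ->
    D u w (fun u' => f u' *: xi u') = differential TA f u w *: xi u + f u *: D u w xi;
  connection_smooth : forall u X xi, slit u ->
    vf_smooth_at TA X u -> pi_smooth_at xi u ->
    pi_smooth_at (fun u' => D u' (X u') xi) u }.

Definition connection_map (D : covariant_derivative) (u : TM) (w : V * V) : V :=
  D u w eta.

Definition regular (D : covariant_derivative) : Prop :=
  forall u, slit u ->
    (forall w, rho u w = 0 -> connection_map D u w = 0 -> w = 0) /\
    (forall w, exists w1 w2,
       [/\ w = w1 + w2, rho u w1 = 0 & connection_map D u w2 = 0]).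

Definition beta (D : covariant_derivative) (u : TM) (v : V) : V * V :=
  xget 0 [set w | connection_map D u w = 0 /\ rho u w = v].

Definition torsion (D : covariant_derivative) (X Y : vfield) (u : TM) : V :=
  D u (X u) (fun u' => rho u' (Y u')) - D u (Y u) (fun u' => rho u' (X u'))
  - rho u (lie_bracket TA X Y u).

Definition torsionQ (D : covariant_derivative) (xi psi : pi_vfield) : TM -> V :=
  torsion D (fun u => beta D u (xi u)) (fun u => beta D u (psi u)).

Definition torsionT (D : covariant_derivative) (xi psi : pi_vfield) : TM -> V :=
  torsion D (fun u => gamma u (xi u)) (fun u => beta D u (psi u)).

Record cartan_connection (L : TM -> R) (D : covariant_derivative) : Prop := {
  cartan_linear : linear_connection D;
  cartan_regular : regular D;
  cartan_metric : forall u w xi psi, slit u ->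
    pi_smooth_at xi u -> pi_smooth_at psi u ->
    differential TA (fun u' => metric L u' (xi u') (psi u')) u w =
    metric L u (D u w xi) (psi u) + metric L u (xi u) (D u w psi);
  cartan_Q : forall u xi psi, slit u ->
    pi_smooth_at xi u -> pi_smooth_at psi u -> torsionQ D xi psi u = 0;
  cartan_T : forall u xi psi chi, slit u ->
    pi_smooth_at xi u -> pi_smooth_at psi u -> pi_smooth_at chi u ->
    metric L u (torsionT D xi psi u) (chi u) =
    metric L u (torsionT D xi chi u) (psi u) }.

Record concurrent (D : covariant_derivative) (zeta : pi_vfield) : Prop := {
  concurrent_smooth : forall u, slit u -> pi_smooth_at zeta u;
  concurrent_horizontal : forall u v, slit u -> D u (beta D u v) zeta = - v;
  concurrent_vertical : forall u v, slit u -> D u (gamma u v) zeta = 0 }.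

Definition d_J (f : TM -> R) (u : TM) (w : V * V) : R := differential TA f u (J u w).

Record canonical_spray (L : TM -> R) (G : vfield) : Prop := {
  spray_smooth : forall u, slit u -> vf_smooth_at TA G u;
  spray_eq : forall u X, slit u -> vf_smooth_at TA X u ->
    ext_deriv TA (d_J (energy L)) G X u = - differential TA (energy L) u (X u) }.

(* the Froelicher-Nijenhuis bracket [J, G] applied to X *)
Definition bracketJ (G X : vfield) (u : TM) : V * V :=
  lie_bracket TA (fun u' => J u' (X u')) G u - J u (lie_bracket TA X G u).

(* Gam is the Barthel connection of L, as an operator on vector fields *)
Definition barthel_connection (L : TM -> R) (Gam : vfield -> vfield) : Prop :=
  exists2 G, canonical_spray L G &
    forall X u, slit u -> vf_smooth_at TA X u -> Gam X u = bracketJ G X u.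

(* omega (x) Z *)
Definition form_tensor (omega : TM -> (V * V)%type -> R) (Z : vfield) (X : vfield) : vfield :=
  fun u => omega u (X u) *: Z u.

End Pullback.

(* Main.v *)
Require Import Defs.
From HB Require Import structures.
From mathcomp Require Import all_boot all_order all_algebra.
From mathcomp Require Import all_classical all_reals all_analysis.
From mathcomp Require Import ring.
Set Implicit Arguments.
Unset Strict Implicit.
Unset Printing Implicit Defensive.
Require Import Defs.
Import Order.TTheory GRing.Theory Num.Theory.
Import numFieldNormedType.Exports.
Local Open Scope classical_set_scope.
Local Open Scope ring_scope.

(** Near a point u of the slit tangent bundle write everything in the preferred
    chart of u, with coordinates (x, y), and put
    b_i = g(zeta, d/dx^i), p2 = g(zeta, zeta), B = g(zeta, eta) = b_i y^i.

    As the Cartan connection is metric and zeta is concurrent, p2 has derivative 0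
    along vertical vectors and -2 g(X, zeta) along the horizontal lift of X.  So
    d p2 = -2 b_i dx^i ([square_norm_differential]): the b_i depend on x alone and
    form a closed 1-form ([lowered_closed]).  The symmetry of the mixed torsion T
    turns this into the same statement for the contravariant components: the
    zeta^i do not depend on y ([concurrent_vertically_constant]).

    Consequently B is linear in y with closed coefficients, and in the
    Euler-Lagrange equations of E + B^2 / 2 along the new spray Gt the terms with
    derivatives of the b_i cancel, leaving g(Gt - G, .) = - (Gt B) b
    ([perturbed_euler_lagrange]).  The old spray is the horizontal lift of eta
    ([spray_beta], which rests on the vanishing of Q), whence
    G B = g(nabla_G zeta, eta) = - L^2, and solving a scalar equation gives
    Gt = G + L^2 / (1 + p2) gamma zeta ([spray_change]).

    Finally, in coordinates the bracket of J with a vertical field V is the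
    derivative of V along J X ([bracketJ_local]).  In the factor of gamma zeta only
    L^2 varies along the fibres, with derivative 2 d_J E (X): this is the formula.

    Two points need preparation.  A tangent vector is given by its components in
    the chart preferred at its base point, so that comparing values at neighbouring
    points always costs a chain rule; this is organised by [good_atlas], which
    holds for the manifold and for its tangent bundle.  And the horizontal map beta
    is given pointwise, by a choice; it is differentiable because regularity makes
    it the solution of an invertible linear system with smooth coefficients
    ([beta_derivable]). *)

(** * Stability of smoothness *)

Section Smooth.
Context (R : realType) (V W : normedModType R).
Implicit Types (f g : V -> W) (U : set V) (x v : V).

Lemma open_near U x (P : V -> Prop) : open U -> U x ->
  (forall z, U z -> P z) -> \forall z \near x, P z.
Proof.
by move=> Uo Ux UP; apply: filterS UP _; exact: open_nbhs_nbhs.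
Qed.

Lemma class_C_ext k U f g : open U -> (forall z, U z -> f z = g z) ->
  class_C k U f -> class_C k U g.
Proof.
elim: k f g => [|k IH] f g Uo fg /=.
  move=> fc x Ux; have fgx : {near x, f =1 g}.
    by apply: open_near fg.
  rewrite /prop_for /continuous_at -(fg x Ux).
  exact: cvg_trans (near_eq_cvg fgx) (fc x Ux).
case=> df Df; split=> [x v Ux|v].
  by apply: near_eq_derivable (df x v Ux); exact: open_near fg.
apply: IH (Df v) => // z Oz; apply: near_eq_derive.
exact: open_near fg.
Qed.

Lemma class_CS k U U' f : U' `<=` U -> class_C k U f -> class_C k U' f.
Proof.
move=> sO; elim: k f => [|k IH] f /=; first by move=> fc x /sO; exact: fc.
by case=> df Df; split=> [x v /sO|v]; [exact: df|exact: IH].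
Qed.

Lemma smooth_near_ext f g x : (\near x, f x = g x) ->
  smooth_near f x -> smooth_near g x.
Proof.
move=> fg; have : nbhs x [set z | f z = g z] by exact: fg.
rewrite nbhsE; move=> [U' [Uo' U'x] U'fg] [U [Uo Ux] Uf].
exists (U `&` U'); first by split; [exact: openI|].
move=> k; apply: (@class_C_ext _ _ f).
- exact: openI.
- by move=> z [_ /U'fg].
- by apply: class_CS (Uf k) => z [].
Qed.

Lemma smooth_near_near f x : smooth_near f x ->
  \forall z \near x, smooth_near f z.
Proof. by case=> U [Uo Ux] Uf; apply: open_near Ux _ => // z Oz; exists U. Qed.

Lemma smooth_near_continuous f x : smooth_near f x -> {for x, continuous f}.
Proof. by case=> U [Uo Ux] /(_ 0%N); exact. Qed.

Lemma smooth_near_derivable f x v : smooth_near f x -> derivable f x v.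
Proof. by case=> U [Uo Ux] /(_ 1%N)[+ _]; exact. Qed.

(** Smoothness being stated by iterated directional derivatives, this is what lets every
    later argument differentiate as often as it likes without counting orders. *)
Lemma smooth_near_D f x v : smooth_near f x -> smooth_near ('D_v f) x.
Proof. by case=> U xO Uf; exists U => // k; have [_] := Uf k.+1; exact. Qed.

Lemma class_C_cst k (c : W) : class_C k [set: V] (fun=> c).
Proof.
elim: k c => [|k IH] c; first by move=> y _; exact: cvg_cst.
split=> [y v _|v]; first exact: derivable_cst.
by apply: class_C_ext (IH 0); [exact: openT|move=> y _; rewrite derive_cst].
Qed.

Lemma smooth_near_cst (c : W) x : smooth_near (fun=> c) x.
Proof.
exists setT; first by split => //; exact: openT.
by move=> k; exact: class_C_cst.
Qed.

Lemma class_CD k U f g : open U -> class_C k U f -> class_C k U g ->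
  class_C k U (fun z => f z + g z).
Proof.
move=> Uo; elim: k f g => [|k IH] f g.
  by move=> fc gc y Oy; apply: cvgD; [exact: fc|exact: gc].
move=> [df Df] [dg Dg]; split=> [y v Oy|v].
  by apply: derivableD; [exact: df|exact: dg].
apply: class_C_ext (IH _ _ (Df v) (Dg v)) => // z Oz.
by rewrite deriveD//; [exact: df|exact: dg].
Qed.

Lemma smooth_nearD f g x : smooth_near f x -> smooth_near g x ->
  smooth_near (fun z => f z + g z) x.
Proof.
move=> [U [Uo Ux] Uf] [U' [Uo' U'x] U'g].
have UUo : open (U `&` U') by exact: openI.
exists (U `&` U') => // k; apply: class_CD => //.
  by apply: class_CS (Uf k) => z [].
by apply: class_CS (U'g k) => z [].
Qed.

Lemma smooth_near_sum (I : Type) (r : seq I) (P : pred I) (F : I -> V -> W) x :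
  (forall i, P i -> smooth_near (F i) x) ->
  smooth_near (fun z => \sum_(i <- r | P i) F i z) x.
Proof.
move=> FP; elim: r => [|i r IH].
  by apply: smooth_near_ext (smooth_near_cst 0 x); near=> z; rewrite big_nil.
case Pi: (P i).
  apply: smooth_near_ext (smooth_nearD (FP i Pi) IH).
  by near=> z; rewrite big_cons Pi.
by apply: smooth_near_ext IH; near=> z; rewrite big_cons Pi.
Unshelve. all: by end_near. Qed.

End Smooth.

Arguments smooth_near_derivable {R V W f x} v _.
Arguments smooth_near_D {R V W f x} v _.

Lemma derive_linear_comp (R : realType) (V W W' : normedModType R) (f : V -> W) (h : {linear W -> W'})
  x v : continuous h -> derivable f x v ->
  derivable (h \o f) x v /\ 'D_v (h \o f) x = h ('D_v f x).
Proof.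
move=> hc /cvg_ex[l fl].
suff H : (fun t => t^-1 *: (((h \o f) \o shift x) (t *: v) - (h \o f) x)) @ 0^' --> h l.
  split; first by apply/cvg_ex; exists (h l).
  by rewrite /derive; rewrite (cvg_lim _ H)// (cvg_lim _ fl).
have -> : (fun t => t^-1 *: (((h \o f) \o shift x) (t *: v) - (h \o f) x)) =
    h \o (fun t => t^-1 *: ((f \o shift x) (t *: v) - f x)).
  by apply/funext => t /=; rewrite linearZ_LR [h (_ - _)]linearB.
exact: cvg_comp fl (hc l).
Qed.

Lemma smooth_near_linear (R : realType) (V W W' : normedModType R) (f : V -> W) (h : {linear W -> W'})
  x : continuous h -> smooth_near f x -> smooth_near (h \o f) x.
Proof.
move=> hc [U [Uo Ux] Uf]; exists U => // k.
have {}Uf := Uf k.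
elim: k f Uf => [|k IH] f; first by move=> fc y Oy; apply: continuous_comp; [exact: fc|exact: hc].
move=> [df Df]; split=> [y v Oy|v]; first by have [] := derive_linear_comp hc (df y v Oy).
apply: class_C_ext (IH _ (Df v)) => // z Oz /=.
by have [_ ->] := derive_linear_comp hc (df z v Oz).
Qed.

Section SmoothR.
Context (R : realType) (V : normedModType R).
Implicit Types (f g : V -> R^o) (U : set V) (x v : V).

(** The induction on the order must be run for all pairs of smooth functions at once:
    the Leibniz rule replaces (f, g) by the two pairs in which one factor is differentiated. *)
Lemma smooth_nearM f g x : smooth_near f x -> smooth_near g x ->
  smooth_near (fun z => f z * g z : R^o) x.
Proof.
move=> [U [Uo Ux] Uf] [U' [Uo' U'x] U'g].
have UUo : open (U `&` U') by exact: openI.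
exists (U `&` U') => // k.
have {}Uf j : class_C j (U `&` U') f by apply: class_CS (Uf j) => z [].
have {}U'g j : class_C j (U `&` U') g by apply: class_CS (U'g j) => z [].
elim: k f g Uf U'g => [|k IH] f g Cf Cg.
  by move=> y Oy; apply: cvgM; [exact: (Cf 0%N)|exact: (Cg 0%N)].
have [df _] := Cf 1%N; have [dg _] := Cg 1%N.
split=> [y v Oy|v]; first by apply: derivableM; [exact: df|exact: dg].
have C1 : class_C k (U `&` U') (fun z => f z * 'D_v g z : R^o).
  by apply: IH => // j; have [_] := Cg j.+1; exact.
have C2 : class_C k (U `&` U') (fun z => g z * 'D_v f z : R^o).
  by apply: IH => // j; have [_] := Cf j.+1; exact.
have C12 := class_CD UUo C1 C2.
apply: class_C_ext C12 => // z Oz.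
by rewrite deriveM//; [exact: df|exact: dg].
Qed.

End SmoothR.

Lemma smooth_near_id (R : realType) (V : normedModType R) (x : V) :
  smooth_near id x.
Proof.
exists setT; first by split => //; exact: openT.
move=> [|k]; first by move=> y _; exact: cvg_id.
split=> [y v _|v]; first exact: derivable_id.
apply: class_C_ext (class_C_cst V k v); first exact: openT.
by move=> z _; rewrite derive_id.
Qed.

Lemma smooth_near_snd (R : realType) (V W : normedModType R) (z : V * W) :
  smooth_near (@snd V W) z.
Proof.
apply: (@smooth_near_linear _ _ _ _ id snd z).
  by move=> y; exact: cvg_snd.
exact: smooth_near_id.
Qed.

(** * Mean values, linearity in the direction, symmetry of second derivatives *)

Section Directional.
Context (R : realType).

Section Line.
Context (U V W : normedModType R).

(** The difference quotients on the two sides are the same function of h.  This is how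
    derivatives are moved along affine maps. *)
Lemma derive_line (f : V -> W) (phi : U -> V) x v v' :
  (forall h : R, phi (h *: v + x) = h *: v' + phi x) ->
  'D_v (f \o phi) x = 'D_v' f (phi x) /\
  (derivable (f \o phi) x v <-> derivable f (phi x) v').
Proof.
move=> H; rewrite /derive /derivable.
suff -> : (fun h : R => h^-1 *: (((f \o phi) \o shift x) (h *: v) - (f \o phi) x)) =
  (fun h : R => h^-1 *: ((f \o shift (phi x)) (h *: v') - f (phi x))) by [].
by apply/funext => h /=; rewrite H.
Qed.

End Line.

Lemma derive_direction_scale (V W : normedModType R) (f : V -> W) a x v : derivable f x v ->
  'D_(a *: v) f x = a *: 'D_v f x /\ derivable f x (a *: v).
Proof.
move=> df; pose phi (h : R) := h *: v + x.
have H1 (h : R) : phi (h *: (1 : R^o) + 0) = h *: v + phi 0.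
  by rewrite /phi addr0 scale0r add0r [_ *: 1]mulr1.
have Ha (h : R) : phi (h *: (a : R^o) + 0) = h *: (a *: v) + phi 0.
  by rewrite /phi addr0 scale0r add0r scalerA.
have phi0 : phi 0 = x by rewrite /phi scale0r add0r.
have [E1 [_ D1]] := derive_line f H1.
have [Ea [Da _]] := derive_line f Ha.
rewrite !phi0 in E1 D1 Ea Da.
have dg : differentiable (f \o phi) 0 by apply/derivable1_diffP/D1.
split; last by apply: Da; exact: diff_derivable.
rewrite -Ea -E1 !deriveE//.
by rewrite -linearZ_LR; congr ('d _ _ _); rewrite [RHS]mulr1.
Qed.

Arguments derive_direction_scale {V W f} a {x v} _.

Section MeanValue.
Context (V : normedModType R).
Implicit Types (f : V -> R^o) (x v w : V).

Lemma mvt_line f x v :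
  (forall t : R, 0 <= t <= 1 -> derivable f (t *: v + x) v) ->
  exists2 c : R, 0 <= c <= 1 & f (v + x) - f x = 'D_v f (c *: v + x).
Proof.
move=> df; pose phi (t : R) := t *: v + x.
have Hphi t (h : R) : phi (h *: (1 : R^o) + t) = h *: v + phi t.
  by rewrite /phi [h *: 1]mulr1 scalerDl addrA.
have Df t : t \in `[0, 1] -> derivable (f \o phi) t 1.
  move=> /itvP t01; have [_ [_ ]] := derive_line f (Hphi t).
  by apply; apply: df; rewrite !t01.
have [||c] := @MVT_segment R (f \o phi) (fun t => 'D_v f (phi t)) 0 1 ler01.
- move=> t t01; have [<- _] := derive_line f (Hphi t).
  by apply/derivableP/Df; exact: subset_itv_oo_cc t01.
- by apply: derivable_within_continuous => t; exact: Df.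
rewrite in_itv/= => c01; rewrite subr0 mulr1 /phi /= scale1r scale0r add0r => fE.
by exists c.
Qed.

Lemma near_normP (P : V -> Prop) x : (\forall z \near x, P z) ->
  exists2 e : R, 0 < e & forall z, `|z| < e -> P (z + x).
Proof.
move=> /nbhs_ballP[e /= e0 He]; exists e => // z ze; apply: He.
by rewrite -ball_normE /ball_/= opprD addrCA subrr addr0 normrN.
Qed.

(** Going from x to x + h v + h w through x + h v, the second step is a mean value of 'D_w f
    near x, and 'D_w f is continuous. *)
Lemma derive_direction_add f x v w : smooth_near f x ->
  'D_(v + w) f x = 'D_v f x + 'D_w f x.
Proof.
move=> fx.
have Dc : {for x, continuous ('D_w f)} by apply/smooth_near_continuous/smooth_near_D.
apply: cvg_lim => //; apply/cvgrPdist_le => e e0.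
have e20 : 0 < e / 2 by rewrite divr_gt0.
have vq := smooth_near_derivable v fx.
move/cvgrPdist_le : vq => /(_ _ e20) vq.
move/cvgrPdist_le : Dc => /(_ _ e20) Dc.
have [d d0 Hd] := near_normP (filterI (smooth_near_near fx) Dc).
near=> h.
have hn0 : h != 0 by near: h; exact: nbhs_dnbhs_neq.
have hd : `|h| * (`|v| + `|w| + 1) < d.
  rewrite -ltr_pdivlMr; last by rewrite ltr_wpDl// addr_ge0.
  by near: h; apply: dnbhs0_lt; rewrite divr_gt0// ltr_wpDl// addr_ge0.
have inb t : 0 <= t <= 1 -> `|t *: (h *: w) + h *: v| < d.
  move=> /andP[t0 t1]; apply: le_lt_trans hd.
  rewrite (le_trans (ler_normD _ _))// !normrZ (ger0_norm t0).
  rewrite mulrDr mulr1 mulrDr addrC -addrA lerD2l -[leLHS]addr0 lerD//.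
  by rewrite ler_piMl// mulr_ge0.
have [|c c01] := @mvt_line f (h *: v + x) (h *: w).
  move=> t /inb tb; rewrite addrA; apply: smooth_near_derivable.
  by have [] := Hd _ tb.
rewrite addrA => fE.
have {fE} -> : h^-1 *: ((f \o shift x) (h *: (v + w)) - f x) =
   'D_w f (c *: (h *: w) + (h *: v + x)) + h^-1 *: (f (h *: v + x) - f x).
  rewrite /= [h *: (v + w)]scalerDr [h *: v + h *: w]addrC -(subrKA (f (h *: v + x))) fE.
  have fs : smooth_near f (c *: (h *: w) + (h *: v + x)).
    by rewrite addrA; have [] := Hd _ (inb _ c01).
  have [-> _] := derive_direction_scale h (smooth_near_derivable w fs).
  by rewrite scalerDr scalerA mulVf// scale1r.
rewrite ['D_v f x + _]addrC opprD addrACA (splitr e) (le_trans (ler_normD _ _))// lerD//.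
  by rewrite addrA; have [] := Hd _ (inb _ c01).
by near: h.
Unshelve. all: by end_near. Qed.

(** Apply the mean value theorem along v to the increment of f in the direction w, and then
    along w to 'D_v f. *)
Lemma second_difference f x v w (d t : R) :
  (forall z, `|z| < d -> smooth_near f (z + x)) ->
  0 < t -> t * (`|v| + `|w|) < d ->
  exists2 z, `|z| < d &
   f (t *: v + t *: w + x) - f (t *: v + x) - f (t *: w + x) + f x =
   t ^+ 2 * 'D_w ('D_v f) (z + x).
Proof.
move=> fs t0 td.
have inb a b : 0 <= a <= 1 -> 0 <= b <= 1 ->
    `|a *: (t *: v) + b *: (t *: w)| < d.
  move=> /andP[a0 a1] /andP[b0 b1]; apply: le_lt_trans td.
  rewrite (le_trans (ler_normD _ _))// !normrZ (ger0_norm a0) (ger0_norm b0).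
  by rewrite (gtr0_norm t0) mulrDr lerD// ler_piMl// mulr_ge0// ltW.
have le01 : 0 <= (1 : R) <= 1 by rewrite ler01 lexx.
have le00 : 0 <= (0 : R) <= 1 by rewrite ler01 lexx.
pose phi y : R^o := f (t *: w + y) - f y.
have shiftD y u : derivable f (t *: w + y) u ->
    derivable (fun y => f (t *: w + y)) y u /\
    'D_u (fun y => f (t *: w + y)) y = 'D_u f (t *: w + y).
  move=> dfu; have H h : t *: w + (h *: u + y) = h *: u + (t *: w + y).
    by rewrite addrCA.
  have [E [_ D]] := derive_line (phi := fun y => t *: w + y) f H.
  by split; [exact: D|exact: E].
have fs1 c : 0 <= c <= 1 -> smooth_near f (t *: w + (c *: (t *: v) + x)).
  move=> c01; have := inb _ _ c01 le01; rewrite scale1r => /fs.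
  by rewrite addrA [_ + t *: w]addrC -!addrA.
have fs0 c : 0 <= c <= 1 -> smooth_near f (c *: (t *: v) + x).
  by move=> c01; have := inb _ _ c01 le00; rewrite scale0r addr0 => /fs.
have [c' c'01|c c01] := @mvt_line phi x (t *: v).
  apply: derivableB; last exact/smooth_near_derivable/fs0.
  by have [] := shiftD _ _ (smooth_near_derivable (t *: v) (fs1 _ c'01)).
have [D1 E1] := shiftD _ _ (smooth_near_derivable (t *: v) (fs1 _ c01)).
rewrite deriveB//; last exact/smooth_near_derivable/fs0.
rewrite E1 {D1 E1}.
have [-> _] := derive_direction_scale t (smooth_near_derivable v (fs1 _ c01)).
have [-> _] := derive_direction_scale t (smooth_near_derivable v (fs0 _ c01)).
have fs2 b : 0 <= b <= 1 -> smooth_near f (b *: (t *: w) + (c *: (t *: v) + x)).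
  move=> b01; have := inb _ _ c01 b01 => /fs.
  by rewrite [X in smooth_near f (X + x) -> _]addrC -addrA.
have [b b01|b b01] := @mvt_line ('D_v f) (c *: (t *: v) + x) (t *: w).
  exact/smooth_near_derivable/smooth_near_D/fs2.
rewrite -scalerBr => ->.
have [-> _] := derive_direction_scale t (smooth_near_derivable w (smooth_near_D v (fs2 _ b01))).
move=> phiE; exists (c *: (t *: v) + b *: (t *: w)); first exact: inb.
rewrite [c *: _ + b *: _]addrC -(addrA (b *: _)) expr2 -mulrA.
apply: etrans phiE.
rewrite /phi !addrA [t *: w + t *: v]addrC; ring.
Qed.

(** The second difference is symmetric in v and w, so by [second_difference] it is both kinds
    of mixed derivative, at two points that tend to x. *)
Lemma derive_derive_sym f x v w : smooth_near f x ->
  'D_w ('D_v f) x = 'D_v ('D_w f) x.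
Proof.
move=> fx; apply/eqP; rewrite -subr_eq0 -normr_le0; apply/ler_addgt0Pl => e e0.
rewrite addr0.
have e20 : 0 < e / 2 by rewrite divr_gt0.
have c1 := smooth_near_continuous (smooth_near_D w (smooth_near_D v fx)).
have c2 := smooth_near_continuous (smooth_near_D v (smooth_near_D w fx)).
move/cvgrPdist_le : c1 => /(_ _ e20) c1.
move/cvgrPdist_le : c2 => /(_ _ e20) c2.
have [d d0 Hd] := near_normP (filterI (smooth_near_near fx) (filterI c1 c2)).
(* small enough for the parallelogram spanned by t v and t w to stay in the ball *)
pose t := d / 2 / (`|v| + `|w| + 1).
have s0 : 0 < `|v| + `|w| + 1 by rewrite ltr_wpDl// addr_ge0.
have t0 : 0 < t by rewrite !divr_gt0.
have td : t * (`|v| + `|w|) < d.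
  apply: (@le_lt_trans _ _ (d / 2)); last by rewrite ltr_pdivrMr// ltr_pMr// ltr1n.
  rewrite -[leRHS](divfK (lt0r_neq0 s0)) -/t.
  by rewrite ler_pM2l// lerDl.
have fs z : `|z| < d -> smooth_near f (z + x) by move=> /Hd[].
have [z1 z1d E1] := second_difference fs t0 td.
rewrite [_ + `|w|]addrC in td.
have [z2 z2d E2] := second_difference fs t0 td.
rewrite [t *: w + t *: v]addrC in E2.
set A := f (_ + x) in E1 E2.
set B1 := f (_ + x) in E1 E2.
set B2 := f (_ + x) in E1 E2.
set C1 := 'D_w ('D_v f) (z1 + x) in E1.
set C2 := 'D_v ('D_w f) (z2 + x) in E2.
have E : C1 = C2.
  have t2 : t ^+ 2 != 0 by rewrite expf_neq0// gt_eqF.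
  have E12 : A - B1 - B2 + f x = A - B2 - B1 + f x by congr (_ + _); exact: addrAC.
  have := etrans (esym E1) (etrans E12 E2).
  exact: (mulfI t2).
rewrite /C1 /C2 {A B1 B2 C1 E1 C2 E2} in E.
have [_ [B1 _]] := Hd _ z1d; have [_ [_ B2]] := Hd _ z2d.
have -> : 'D_w ('D_v f) x - 'D_v ('D_w f) x =
    ('D_w ('D_v f) x - 'D_w ('D_v f) (z1 + x)) -
    ('D_v ('D_w f) x - 'D_v ('D_w f) (z2 + x)).
  by rewrite E opprB addrA subrK.
apply: le_trans (ler_normB _ _) _; rewrite (splitr e).
exact: lerD B1 B2.
Qed.

End MeanValue.
End Directional.

(** * Smooth maps between finite-dimensional spaces are differentiable *)

Section FiniteDimension.
Context (R : realType).

(** A finite spanning family with continuous coordinate functions: all that is used of finite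
    dimension, and a form that passes to products at once. *)
Definition finite_dim (V : normedModType R) : Prop :=
  exists m, exists (b : 'I_m -> V) (c : 'I_m -> {linear V -> R^o}),
    (forall i, continuous (c i)) /\ forall v, v = \sum_i c i v *: b i.

Lemma finite_dim_rV n : finite_dim 'rV[R]_n.
Proof.
pose c (i : 'I_n) (v : 'rV[R]_n) : R^o := v 0 i.
have cl i : linear (c i) by move=> a u v; rewrite /c !mxE.
pose cL i : {linear 'rV[R]_n -> R^o} :=
  HB.pack (c i) (GRing.isLinear.Build _ _ _ _ _ (cl i)).
exists n, (fun i => delta_mx 0 i), cL; split=> [i|v].
  exact: coord_continuous.
exact: row_sum_delta.
Qed.

Lemma finite_dim_prod (V W : normedModType R) :
  finite_dim V -> finite_dim W -> finite_dim (V * W)%type.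
Proof.
move=> [m [b [c [cc cE]]]] [m' [b' [c' [cc' cE']]]].
pose B i : (V * W)%type :=
  match fintype.split i with inl j => (b j, 0) | inr j => (0, b' j) end.
pose C (i : 'I_(m + m')) (v : V * W) : R^o :=
  match fintype.split i with inl j => c j v.1 | inr j => c' j v.2 end.
have Cl i : linear (C i).
  by move=> a u v; rewrite /C; case: (fintype.split i) => j; rewrite linearP.
pose CL i : {linear (V * W)%type -> R^o} :=
  HB.pack (C i) (GRing.isLinear.Build _ _ _ _ _ (Cl i)).
exists (m + m')%N, B, CL; split=> [i|v].
  rewrite /CL /= /C => x; case: (fintype.split i) => j.
    by apply: (@continuous_comp _ _ _ fst (c j)); [exact: cvg_fst|exact: cc].
  by apply: (@continuous_comp _ _ _ snd (c' j)); [exact: cvg_snd|exact: cc'].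
rewrite big_split_ord /= /C /B.
under eq_bigr do rewrite (unsplitK (inl _)).
under [X in _ + X]eq_bigr do rewrite (unsplitK (inr _)).
case: v => v w /=; apply/pair_equal_spec; rewrite /=; split.
  rewrite [RHS]/= -[RHS]/(fst (_ + _)) raddfD !raddf_sum /=.
  rewrite [X in _ + X]big1 ?addr0; last by move=> i _; rewrite scaler0.
  by rewrite {1}(cE v).
rewrite -[RHS]/(snd (_ + _)) raddfD !raddf_sum /=.
rewrite [X in X + _]big1 ?add0r; last by move=> i _; rewrite scaler0.
by rewrite {1}(cE' w).
Qed.

Lemma smooth_near_derive_comb (V : normedModType R) (f : V -> R^o) x
    (I : Type) (r : seq I) (P : pred I) (a : I -> R) (b : I -> V) :
  smooth_near f x ->
  'D_(\sum_(i <- r | P i) a i *: b i) f x = \sum_(i <- r | P i) a i * 'D_(b i) f x.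
Proof.
move=> fx; elim/big_rec2: _ => [|i y z _ IH]; first by rewrite derive0.
rewrite derive_direction_add// IH; have [-> _] := derive_direction_scale (a i) (smooth_near_derivable (b i) fx).
by [].
Qed.

(** The increment f (h + x) - f x is 'D_h f at an intermediate point, and 'D_h f is a
    combination of finitely many continuous partial derivatives with coefficients linear in h. *)
Lemma smooth_near_differentiableR (V : normedModType R) (f : V -> R^o) x :
  finite_dim V -> smooth_near f x -> differentiable f x.
Proof.
move=> [m [b [c [cc cE]]]] fx.
pose A (h : V) : R^o := \sum_i c i h * 'D_(b i) f x.
have Al : linear A.
  move=> a u v; rewrite /A scaler_sumr -big_split/=; apply: eq_bigr => i _.
  by rewrite linearP mulrDl -mulrA.
pose AL : {linear V -> R^o} :=
  HB.pack A (GRing.isLinear.Build _ _ _ _ _ Al).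
have Ac : continuous A.
  move=> y; rewrite /A; apply: cvg_big => [|i _]; first exact: add_continuous.
  apply: cvgM; first exact: cc.
  exact: cvg_cst.
have [k k0 ck] : exists2 k : R, 0 < k & forall i h, `|c i h| <= k * `|h|.
  have H i := linear_lipschitz (cc i).
  pose K i := sval (cid2 (H i)).
  have K0 i : 0 < K i by rewrite /K; case: cid2.
  have KP i h : `|c i h| <= K i * `|h| by rewrite /K; case: cid2.
  exists (1 + \sum_i K i).
    by rewrite ltr_wpDr// sumr_ge0// => i _; exact: ltW.
  move=> i h; apply: le_trans (KP i h) _; rewrite ler_wpM2r//.
  rewrite (bigD1 i)//= addrCA lerDl addr_ge0// sumr_ge0// => j _.
  exact: ltW.
have E : f \o shift x = cst (f x) + AL +o_ 0 id.
  apply/eqaddoP => e e0.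
  (* the m terms of the sum are each at most k * |h| * e'; the + 1 covers m = 0 *)
  pose e' := e / (k * (m%:R + 1)).
  have e'0 : 0 < e' by rewrite divr_gt0// mulr_gt0// ltr_wpDl.
  have Dc : \forall z \near x, forall i, `|'D_(b i) f x - 'D_(b i) f z| <= e'.
    apply: filter_forall => i.
    by have /cvgrPdist_le/(_ _ e'0) := smooth_near_continuous (smooth_near_D (b i) fx).
  have [d d0 Hd] := near_normP (filterI (smooth_near_near fx) Dc).
  near=> h.
  have hd : `|h| < d by near: h; exact: nbhs0_lt.
  have inb t : 0 <= t <= 1 -> `|t *: h| < d.
    move=> /andP[t0 t1]; apply: le_lt_trans hd.
    by rewrite normrZ ger0_norm// ler_piMl.
  have [t t01|t t01 tE] := @mvt_line R V f x h.
    by apply: smooth_near_derivable; have [] := Hd _ (inb _ t01).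
  have [ft Dt] := Hd _ (inb _ t01).
  suff H : `|f (h + x) - f x - A h| <= e * `|h|.
    by move: H; rewrite -addrA -opprD.
  have Dh : 'D_h f (t *: h + x) = \sum_i c i h * 'D_(b i) f (t *: h + x).
    by rewrite -smooth_near_derive_comb// -cE.
  rewrite tE Dh /A -sumrB.
  rewrite (le_trans (ler_norm_sum _ _ _))//.
  apply: (@le_trans _ _ (\sum_(i < m) k * `|h| * e')).
    apply: ler_sum => i _; rewrite -mulrBr normrM distrC ler_pM//.
  rewrite sumr_const card_ord -mulr_natr.
  have -> : e = e' * (k * (m%:R + 1)) by rewrite divfK// gt_eqF// mulr_gt0// ltr_wpDl.
  have := normr_ge0 h; move: (`|h|) => nh nh0.
  have -> : e' * (k * (m%:R + 1)) * nh = k * nh * e' * m%:R + k * nh * e' by ring.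
  rewrite lerDl; apply: mulr_ge0; last exact: ltW.
  by apply: mulr_ge0 => //; exact: ltW.
have dE : 'd f x = AL :> (V -> R^o) by apply: diff_unique.
by apply/diff_locallyP; rewrite dE; split.
Unshelve. all: by end_near. Qed.

Lemma smooth_near_differentiable (V W : normedModType R) (f : V -> W) x :
  finite_dim V -> finite_dim W -> smooth_near f x -> differentiable f x.
Proof.
move=> fV [m [b [c [cc cE]]]] fx.
have -> : f = \sum_(i < m) (fun z => c i (f z) *: b i).
  by apply/funext => z; rewrite fct_sumE -cE.
apply: differentiable_sum => i; apply: differentiableZl.
by apply: smooth_near_differentiableR => //; exact: smooth_near_linear.
Qed.

End FiniteDimension.

(** * Complements on differentiability *)

Lemma near_fst (X Y : topologicalType) (P : X -> Prop) (x : X) (y : Y) :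
  (\forall a \near x, P a) -> \forall z \near (x, y), P z.1.
Proof. by move=> xP; exact: (@cvg_fst X Y (nbhs x) (nbhs y) _ P xP). Qed.

Arguments near_fst {X Y P x} y _.

Section DifferentiableExtra.
Context (R : realType).

(** The difference of f and g vanishes near x, hence is differentiable with differential 0. *)
Lemma near_eq_differentiable (V W : normedModType R) (f g : V -> W) x :
  (\near x, f x = g x) -> differentiable f x -> differentiable g x.
Proof.
move=> fg df; pose h := g - f.
have h0 : \forall z \near x, h z = 0.
  by near=> z; rewrite /h -[LHS]/(g z - f z) (near fg)// subrr.
have -> : g = f + h by rewrite /h addrC subrK.
apply: differentiableD; first by [].
have hx : h x = 0 by exact: nbhs_singleton h0.
have E : h \o shift x = cst (h x) + (\0 : {linear V -> W}) +o_ 0 id.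
  apply/eqaddoP => e e0; have [d d0 Hd] := near_normP h0.
  near=> v; rewrite -[X in Num.norm X]/(h (v + x) - (h x + 0)) Hd.
    by rewrite hx addr0 subrr normr0 mulr_ge0// ltW.
  by near: v; exact: nbhs0_lt.
have c0 : continuous (\0 : {linear V -> W}) by move=> y; exact: cvg_cst.
have dE : 'd h x = (\0 : {linear V -> W}) :> (V -> W) by apply: diff_unique.
by apply/diff_locallyP; rewrite dE; split.
Unshelve. all: by end_near. Qed.

Lemma differentiable_rV (V : normedModType R) n (f : V -> 'rV[R]_n) x :
  (forall l, differentiable (fun z => f z 0 l : R^o) x) -> differentiable f x.
Proof.
move=> df.
have -> : f = \sum_(l < n) (fun z => (f z 0 l : R^o) *: (delta_mx 0 l : 'rV[R]_n)).
  by apply/funext => z; rewrite fct_sumE -row_sum_delta.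
by apply: differentiable_sum => l; exact: differentiableZl.
Qed.

Lemma differentiable_entry n (k : 'I_n) (v : 'rV[R]_n) :
  differentiable (fun v : 'rV[R]_n => v 0 k : R^o) v.
Proof.
have cl : linear (fun v : 'rV[R]_n => v 0 k : R^o) by move=> a u w; rewrite !mxE.
pose cL : {linear 'rV[R]_n -> R^o} :=
  HB.pack (fun v : 'rV[R]_n => v 0 k : R^o) (GRing.isLinear.Build _ _ _ _ _ cl).
rewrite -[X in differentiable X _]/(cL : 'rV[R]_n -> R^o).
exact/linear_differentiable/coord_continuous.
Qed.

Lemma differentiable_fst (V W : normedModType R) (z : V * W) :
  differentiable (@fst V W) z.
Proof. by apply: linear_differentiable => y; exact: cvg_fst. Qed.

Lemma differentiable_snd (V W : normedModType R) (z : V * W) :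
  differentiable (@snd V W) z.
Proof. by apply: linear_differentiable => y; exact: cvg_snd. Qed.

Lemma derive_direction_linear (V W : normedModType R) (f : V -> W) x a v w :
  differentiable f x -> 'D_(a *: v + w) f x = a *: 'D_v f x + 'D_w f x.
Proof. by move=> df; rewrite !deriveE// linearP. Qed.

Lemma derive_comp (U V W : normedModType R) (f : U -> V) (g : V -> W) x v :
  differentiable f x -> differentiable g (f x) ->
  'D_v (g \o f) x = 'D_('D_v f x) g (f x).
Proof.
move=> df dg; rewrite !deriveE//; last exact: differentiable_comp.
by rewrite diff_comp.
Qed.

Lemma derive_pair (U V W : normedModType R) (f : U -> V) (g : U -> W) x v :
  differentiable f x -> differentiable g x ->
  'D_v (fun z => (f z, g z)) x = ('D_v f x, 'D_v g x).
Proof.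
move=> df dg; rewrite !deriveE//; last exact: differentiable_pair.
by rewrite diff_pair.
Qed.

Lemma derive_of_linear (V W : normedModType R) (f : V -> W) x v :
  linear f -> 'D_v f x = f v.
Proof.
move=> fl; rewrite /derive; apply: lim_near_cst => //; near=> h.
have h0 : h != 0 by near: h; exact: nbhs_dnbhs_neq.
by rewrite /= fl addrK scalerA mulVf// scale1r.
Unshelve. all: by end_near. Qed.

Lemma derive_vertical (U V W : normedModType R) (f : U * V -> W) z v :
  'D_(0, v) f z = 'D_v (fun y => f (z.1, y)) z.2.
Proof.
have H h : (z.1, h *: v + z.2) = h *: (0, v) + (z.1, z.2) :> U * V.
  by congr pair => /=; rewrite scaler0 add0r.
by have [-> _] := derive_line (phi := fun y => (z.1, y)) f H; case: z H.
Qed.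

Lemma derive_horizontal (U V W : normedModType R) (f : U * V -> W) z v :
  'D_(v, 0) f z = 'D_v (fun x => f (x, z.2)) z.1.
Proof.
have H h : (h *: v + z.1, z.2) = h *: (v, 0) + (z.1, z.2) :> U * V.
  by congr pair => /=; rewrite scaler0 add0r.
by have [-> _] := derive_line (phi := fun y => (y, z.2)) f H; case: z H.
Qed.

End DifferentiableExtra.

(** * Change of chart for tangent vectors *)

Section GoodAtlas.
Context (R : realType) (V : normedModType R) (X : Type) (A : atlas V X).

(** What the calculus of tangent vectors needs from an atlas, stated without reference to a
    topology on X so that it also applies to the tangent bundle, whose topology is only
    given through its charts. *)
Record good_atlas : Prop := {
  good_dom : forall x, dom A (chart_at A x) x;
  goodK : forall i x, dom A i x -> param A i (chart A i x) = x;
  good_near : forall i j x, dom A i x -> dom A j x ->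
    \forall z \near chart A i x,
      [/\ dom A i (param A i z), dom A j (param A i z) & chart A i (param A i z) = z];
  good_differentiable : forall i j x, dom A i x -> dom A j x ->
    differentiable (chart A j \o param A i) (chart A i x) }.

(** The inverse of [components i x]: from components in chart i to components in the chart
    preferred at x. *)
Definition frame (i : index A) (x : X) (v : V) : V :=
  'D_v (chart A (chart_at A x) \o param A i) (chart A i x).

Context (AP : good_atlas).

(** Near x in chart i, f read in chart i is f read in chart j after the transition map. *)
Lemma good_chain (W : normedModType R) (f : X -> W) i j x v :
  dom A i x -> dom A j x -> differentiable (f \o param A j) (chart A j x) ->
  differentiable (f \o param A i) (chart A i x) /\
  'D_v (f \o param A i) (chart A i x) =
  'D_('D_v (chart A j \o param A i) (chart A i x)) (f \o param A j) (chart A j x).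
Proof.
move=> ix jx df; have dij := good_differentiable AP ix jx.
have E : \forall z \near chart A i x,
    (f \o param A j \o (chart A j \o param A i)) z = (f \o param A i) z.
  near=> z; rewrite /= (goodK AP)//.
  by have [] : [/\ dom A i (param A i z), dom A j (param A i z) &
    chart A i (param A i z) = z] by near: z; exact: good_near.
have xE : (chart A j \o param A i) (chart A i x) = chart A j x.
  by rewrite /= (goodK AP).
split.
  apply: near_eq_differentiable E _.
  by apply: differentiable_comp => //; rewrite xE.
by rewrite -(near_eq_derive _ E) derive_comp// xE.
Unshelve. all: by end_near. Qed.

Lemma good_cocycle i j k x v : dom A i x -> dom A j x -> dom A k x ->
  'D_('D_v (chart A j \o param A i) (chart A i x)) (chart A k \o param A j) (chart A j x)
  = 'D_v (chart A k \o param A i) (chart A i x).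
Proof.
move=> ix jx kx.
by have [_ ->] := @good_chain _ (chart A k) i j x v ix jx (good_differentiable AP jx kx).
Qed.

Lemma good_derive_id i x v : dom A i x ->
  'D_v (chart A i \o param A i) (chart A i x) = v.
Proof.
move=> ix; rewrite -[RHS](derive_id (chart A i x) v); apply: near_eq_derive.
near=> z; rewrite /=.
by have [] : [/\ dom A i (param A i z), dom A i (param A i z) &
    chart A i (param A i z) = z] by near: z; exact: good_near.
Unshelve. all: by end_near. Qed.

Lemma frameK i x : dom A i x -> cancel (frame i x) (components (A := A) i x).
Proof.
move=> ix v; rewrite /components /coord good_cocycle//; last exact: good_dom.
exact: good_derive_id.
Qed.

Lemma componentsK i x : dom A i x -> cancel (components (A := A) i x) (frame i x).
Proof.
move=> ix v; rewrite /frame /components /coord good_cocycle//; try exact: good_dom.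
by rewrite good_derive_id//; exact: good_dom.
Qed.

Lemma components_own x v : components (A := A) (chart_at A x) x v = v.
Proof. by rewrite /components /coord good_derive_id//; exact: good_dom. Qed.

Lemma frame_own x v : frame (chart_at A x) x v = v.
Proof. by rewrite /frame good_derive_id//; exact: good_dom. Qed.

Lemma componentsP i x a v w : dom A i x ->
  components (A := A) i x (a *: v + w) =
  a *: components (A := A) i x v + components (A := A) i x w.
Proof.
move=> ix; apply: derive_direction_linear; apply: good_differentiable => //.
exact: good_dom.
Qed.

Lemma componentsZ i x a v : dom A i x ->
  components (A := A) i x (a *: v) = a *: components (A := A) i x v.
Proof.
move=> ix; have := componentsP a v 0 ix.
by rewrite addr0 => ->; rewrite {2}/components derive0 addr0.
Qed.

Lemma componentsD i x v w : dom A i x ->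
  components (A := A) i x (v + w) =
  components (A := A) i x v + components (A := A) i x w.
Proof. by move=> ix; have := componentsP 1 v w ix; rewrite !scale1r. Qed.

Lemma frameP i x a v w : dom A i x ->
  frame i x (a *: v + w) = a *: frame i x v + frame i x w.
Proof.
move=> ix; apply: derive_direction_linear; apply: good_differentiable => //.
exact: good_dom.
Qed.

Lemma frameZ i x a v : dom A i x -> frame i x (a *: v) = a *: frame i x v.
Proof.
move=> ix; have := frameP a v 0 ix.
by rewrite addr0 => ->; rewrite {2}/frame derive0 addr0.
Qed.

(** [differential] is taken in the chart preferred at x; this reads it in a fixed chart, which
    is what comparing the values at neighbouring points requires. *)
Lemma differential_chart (f : X -> R^o) i x v : dom A i x ->
  differentiable (f \o param A (chart_at A x)) (coord A x) ->
  differential A f x v = 'D_(components (A := A) i x v) (f \o param A i) (chart A i x).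
Proof.
move=> ix df; have [df' _] := good_chain 0 ix (good_dom AP x) df.
by rewrite /differential /coord; have [_ ->] := good_chain v (good_dom AP x) ix df'.
Qed.

End GoodAtlas.

(** * The atlas of the tangent bundle *)

Section TangentAtlas.
Context (R : realType) (n : nat) (M : manifold R n).
Let V := 'rV[R]_n.
Let A := matlas M.

Lemma manifold_atlas_good : good_atlas A.
Proof.
have K i x : dom A i x -> param A i (chart A i x) = x.
  by move=> ix; apply: chartK; rewrite inE.
split=> [x|//|i j x ix jx|i j x ix jx].
- exact: dom_chart_at.
- have Hi : \forall z \near chart A i x, (chart A i @` dom A i) z.
    by apply: open_nbhs_nbhs; split; [exact: chart_open|exists x].
  have Hj : \forall z \near chart A i x, dom A j (param A i z).
    have pc := param_continuous ix.
    apply: pc; rewrite K//; apply: open_nbhs_nbhs; split=> //.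
    exact: dom_open.
  near=> z; have [y iy yz] : (chart A i @` dom A i) z by near: z.
  split; [by rewrite -yz K|by near: z|by rewrite -yz K].
- apply: smooth_near_differentiable; try exact: finite_dim_rV.
  exact: transition_smooth.
Unshelve. all: by end_near. Qed.

Let AP := manifold_atlas_good.
Let T := TA M.

Lemma paramTE i z : param T i z =
  (param A i z.1, 'D_(z.2) (chart A (chart_at A (param A i z.1)) \o param A i) z.1).
Proof. by []. Qed.

Lemma chartTE i u : chart T i u = (chart A i u.1, components (A := A) i u.1 u.2).
Proof. by []. Qed.

(** Near a point the transition maps of the tangent bundle are the tangent maps of those of M.
    The intermediate charts preferred at each base point disappear by the cocycle rule. *)
Lemma transitionTE (i j : index A) x (y : V) : dom A i x -> dom A j x ->
  \forall z \near (chart A i x, y),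
    (chart T j \o param T i) z =
    ((chart A j \o param A i) z.1, 'D_(z.2) (chart A j \o param A i) z.1).
Proof.
move=> ix jx; have N := near_fst y (good_near AP ix jx); near=> z.
have [iz jz zE] : [/\ dom A i (param A i z.1), dom A j (param A i z.1) &
   chart A i (param A i z.1) = z.1].
  by near: z; exact: N.
rewrite -[LHS]/(chart T j (param T i z)) chartTE paramTE /components /coord.
move: (param A i z.1) iz jz zE => q iq jq zE.
congr pair; first by rewrite /= -zE (goodK AP).
rewrite [LHS]/= -zE.
by apply: (good_cocycle AP) => //; exact: (good_dom AP).
Unshelve. all: by end_near. Qed.

(** A sum of products of the fibre coordinates with the partial derivatives of a smooth map. *)
Lemma transitionT_differentiable (i j : index A) x (y : V) : dom A i x -> dom A j x ->
  differentiable (fun z : V * V => 'D_(z.2) (chart A j \o param A i) z.1) (chart A i x, y).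
Proof.
move=> ix jx; set tau := chart A j \o param A i.
have ts : smooth_near tau (chart A i x) by exact: transition_smooth.
have fV := @finite_dim_rV R n.
have E : \forall z \near (chart A i x, y),
   \sum_k ((z : V * V).2 0 k) *: 'D_(delta_mx 0 k : V) tau z.1 = 'D_(z.2) tau z.1.
  have N := near_fst y (smooth_near_near ts).
  near=> z; rewrite /=.
  have tz : smooth_near tau z.1.
    by near: z; exact: N.
  have dt : differentiable tau z.1 by exact: smooth_near_differentiable.
  rewrite [in RHS](row_sum_delta z.2) deriveE// linear_sum; apply: eq_bigr => k _.
  by rewrite linearZ deriveE.
apply: near_eq_differentiable E _; apply: differentiable_rV => l.
have -> : (fun z : V * V => (\sum_k z.2 0 k *: 'D_(delta_mx 0 k : V) tau z.1) 0 l : R^o) =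
  \sum_k (fun z : V * V => z.2 0 k * 'D_(delta_mx 0 k : V) tau z.1 0 l : R^o).
  by apply/funext => z; rewrite fct_sumE summxE; apply: eq_bigr => k _; rewrite mxE.
apply: differentiable_sum => k; apply: differentiableM.
  apply: (@differentiable_comp _ _ _ _ snd (fun v : V => v 0 k : R^o)).
    exact: differentiable_snd.
  exact: differentiable_entry.
apply: (@differentiable_comp _ _ _ _ fst (fun x : V => 'D_(delta_mx 0 k : V) tau x 0 l : R^o)).
  exact: differentiable_fst.
apply: (@differentiable_comp _ _ _ _ _ (fun v : V => v 0 l : R^o)).
  by apply: smooth_near_differentiable => //; exact: smooth_near_D.
exact: differentiable_entry.
Unshelve. all: by end_near. Qed.

Lemma tangent_atlas_good : good_atlas T.
Proof.
have D i (u : TM M) : dom T i u = dom A i u.1 by [].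
split=> [u|i u|i j u|i j u]; rewrite ?D.
- exact: good_dom.
- move=> iu; rewrite paramTE chartTE /=; case: u iu => x y /= ix.
  by congr pair; rewrite ?(goodK AP)//; exact: componentsK.
- move=> iu ju; rewrite chartTE.
  have N := near_fst (components (A := A) i u.1 u.2) (good_near AP iu ju).
  near=> z; rewrite chartTE paramTE /=.
  have [iz jz zE] : [/\ dom A i (param A i z.1), dom A j (param A i z.1) &
     chart A i (param A i z.1) = z.1].
    by near: z; exact: N.
  move: (param A i z.1) iz jz zE => q iq jq zE; split=> //.
  by rewrite [RHS]surjective_pairing -zE; congr pair; exact: frameK.
- move=> iu ju; rewrite chartTE.
  have E := transitionTE (components (A := A) i u.1 u.2) iu ju.
  apply: near_eq_differentiable; first by near=> z; apply/esym; near: z; exact: E.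
  apply: differentiable_pair; last exact: transitionT_differentiable.
  apply: (@differentiable_comp _ _ _ _ fst (chart A j \o param A i)).
    exact: differentiable_fst.
  exact: (good_differentiable AP).
Unshelve. all: by end_near. Qed.

End TangentAtlas.

(** * The canonical maps of the tangent bundle in coordinates *)

Section OwnChart.
Context (R : realType) (n : nat) (M : manifold R n).
Let V := 'rV[R]_n.
Let A := matlas M.
Let AP : good_atlas A := manifold_atlas_good M.
Let T := TA M.
Let TP : good_atlas T := tangent_atlas_good M.

Lemma coordTE (u : TM M) : coord T u = (coord A u.1, u.2).
Proof. by rewrite /coord chartTE components_own. Qed.

Lemma componentsTE (i : index A) (u : TM M) (w : V * V) : dom A i u.1 ->
  components (A := T) i u w =
  (components (A := A) i u.1 w.1,
   'D_w (fun z : V * V =>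
      'D_(z.2) (chart A i \o param A (chart_at A u.1)) z.1) (coord T u)).
Proof.
move=> iu; rewrite /components.
have cu := good_dom AP u.1.
have E := transitionTE u.2 cu iu.
have d1 : differentiable ((chart A i \o param A (chart_at A u.1)) \o fst)
    ((coord A u.1, u.2) : V * V).
  apply: differentiable_comp; first exact: differentiable_fst.
  exact: (good_differentiable AP).
have d2 := transitionT_differentiable u.2 cu iu.
rewrite coordTE (near_eq_derive _ E).
apply: etrans (derive_pair w d1 d2) _; congr pair.
Qed.

(** A change of chart of the tangent bundle is triangular: the base part of a vector is
    transformed without regard to its vertical part, and vertical vectors stay vertical. *)
Lemma componentsT_fst (i : index A) (u : TM M) (w : V * V) : dom A i u.1 ->
  (components (A := T) i u w).1 = components (A := A) i u.1 w.1.
Proof. by move=> iu; rewrite componentsTE. Qed.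

Lemma componentsT_vertical (i : index A) (u : TM M) (v : V) : dom A i u.1 ->
  components (A := T) i u (0, v) = (0, components (A := A) i u.1 v).
Proof.
move=> iu; rewrite componentsTE//; congr pair.
  by rewrite /components derive0.
rewrite coordTE derive_vertical /=; apply: derive_of_linear => a x y.
exact: (componentsP AP).
Qed.

(** At u both sides are read in the chart preferred at u, so the canonical maps rho, gamma and
    J take their textbook form on components. *)
Lemma rhoE (u : TM M) (w : V * V) : rho u w = w.1.
Proof.
rewrite /rho /tangent_map coordTE.
have [H _] := @derive_line _ _ _ _ (chart A (chart_at A u.1) \o param A (chart_at A u.1)) fst
  ((coord A u.1, u.2) : V * V) w w.1 (fun h => erefl).
apply: etrans H _.
exact: (good_derive_id AP _ (good_dom AP u.1)).
Qed.

Lemma gammaE (u : TM M) (v : V) : gamma u v = (0, v).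
Proof.
rewrite /gamma.
have -> : (fun y => chart T (chart_at T u) (u.1, y)) = (fun y => (coord A u.1, y)).
  by apply/funext => y; rewrite chartTE /= components_own.
have H h : (coord A u.1, h *: v + u.2) = h *: (0, v) + (coord A u.1, u.2) :> V * V.
  by congr pair => /=; rewrite scaler0 add0r.
have [D _] := @derive_line _ _ _ _ id (fun y => (coord A u.1, y)) _ _ _ H.
by apply: etrans D _; rewrite derive_id.
Qed.

Lemma JE (u : TM M) (w : V * V) : J u w = (0, w.1).
Proof. by rewrite /J gammaE rhoE. Qed.

(** The coordinates at which the computations around u take place; they fill a neighbourhood
    of the coordinates of u by [near_in_chart]. *)
Definition in_chart (u : TM M) (z : V * V) : Prop :=
  let p := param T (chart_at T u) z in
  [/\ slit (p : TM M), dom T (chart_at T u) p & chart T (chart_at T u) p = z].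

(** The fibre coordinate of a point read in a chart depends linearly on the tangent vector, so
    it can be nonzero only if the vector is. *)
Lemma near_in_chart (u : TM M) : slit u -> \forall z \near coord T u, in_chart u z.
Proof.
move=> us; have cu := good_dom TP u.
have N := good_near TP cu cu.
have y0 : \forall z \near coord T u, z.2 != 0.
  rewrite coordTE.
  have y0 : \forall y \near u.2, y != 0.
    apply/nbhs_ballP; exists `|u.2|; first by rewrite /= normr_gt0.
    by move=> y; rewrite -ball_normE /ball_/=; apply: contraTneq => ->; rewrite subr0 ltxx.
  exact: (@cvg_snd V V (nbhs (coord A u.1)) (nbhs u.2) _ _ y0).
near=> z.
have [dz _ zE] : [/\ dom T (chart_at T u) (param T (chart_at T u) z),
  dom T (chart_at T u) (param T (chart_at T u) z) &
  chart T (chart_at T u) (param T (chart_at T u) z) = z] by near: z; exact: N.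
have z0 : z.2 != 0 by near: z.
split => //; apply: contra_neq z0 => pz.
rewrite -zE chartTE pz /=.
by rewrite /components derive0.
Unshelve. all: by end_near. Qed.

End OwnChart.

(** * Derivatives of a pairing *)

Lemma near_slice (X Y : topologicalType) (P : X * Y -> Prop) (z : X * Y) :
  (\forall y \near z, P y) -> \forall x \near z.1, P (x, z.2).
Proof.
move=> Pz.
have c : (fun x => (x, z.2)) @ z.1 --> (z.1, z.2).
  by apply: cvg_pair; [exact: cvg_id|exact: cvg_cst].
by rewrite -surjective_pairing in c; exact: c Pz.
Qed.

Lemma near_fibre (X Y : topologicalType) (P : X * Y -> Prop) (z : X * Y) :
  (\forall y \near z, P y) -> \forall y \near z.2, P (z.1, y).
Proof.
move=> Pz.
have c : (fun y => (z.1, y)) @ z.2 --> (z.1, z.2).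
  by apply: cvg_pair; [exact: cvg_cst|exact: cvg_id].
by rewrite -surjective_pairing in c; exact: c Pz.
Qed.

Section Pairing.
Context (R : realType).

Lemma smooth_near_entry (Z : normedModType R) n (f : Z -> 'rV[R]_n) k z :
  smooth_near f z -> smooth_near (fun y => f y 0 k : R^o) z.
Proof.
move=> fs.
have cl : linear (fun v : 'rV[R]_n => v 0 k : R^o) by move=> a x y; rewrite !mxE.
pose cL : {linear 'rV[R]_n -> R^o} :=
  HB.pack (fun v : 'rV[R]_n => v 0 k : R^o) (GRing.isLinear.Build _ _ _ _ _ cl).
by apply: (@smooth_near_linear _ _ _ _ f cL) => //; exact: coord_continuous.
Qed.

Lemma linear_row_expansion n (F : 'rV[R]_n -> R^o) v :
  (forall a v v', F (a *: v + v') = a * F v + F v') ->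
  F v = \sum_k v 0 k * F (delta_mx 0 k).
Proof.
move=> lF; rewrite {1}(row_sum_delta v).
elim/big_rec2: _ => [|k s t _ <-]; last exact: lF.
by have := lF (-1) 0 0; rewrite scaler0 addr0 mulN1r addNr.
Qed.

(** Expand g in the canonical basis.  Together with [derive_pairing] this handles all
    expressions that are linear in a varying vector: metric, 1-forms, vertical derivatives. *)
Lemma smooth_near_pairing (Z : normedModType R) n (F : 'rV[R]_n -> Z -> R^o)
    (g : Z -> 'rV[R]_n) z :
  (forall v, smooth_near (F v) z) -> smooth_near g z ->
  (\forall y \near z, forall a v v', F (a *: v + v') y = a * F v y + F v' y) ->
  smooth_near (fun y => F (g y) y) z.
Proof.
move=> Fs gs lF.
have S : smooth_near (fun y => \sum_k (fun k y => g y 0 k * F (delta_mx 0 k) y : R^o) k y) z.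
  apply: smooth_near_sum => k _.
  exact: (smooth_nearM (smooth_near_entry k gs) (Fs (delta_mx 0 k))).
apply: smooth_near_ext S; apply: filterS lF => y lFy.
exact/esym/(linear_row_expansion (F := F^~ y)).
Qed.

(** The Leibniz rule for evaluating a varying linear form F on a varying vector g. *)
Lemma derive_pairing (Z : normedModType R) n (F : 'rV[R]_n -> Z -> R^o)
    (g : Z -> 'rV[R]_n) z w :
  (forall v, derivable (F v) z w) -> derivable g z w ->
  (\forall y \near z, forall a v v', F (a *: v + v') y = a * F v y + F v' y) ->
  derivable (fun y => F (g y) y) z w /\
  'D_w (fun y => F (g y) y) z = 'D_w (F (g z)) z + F ('D_w g z) z.
Proof.
move=> dF dg lF.
have dgk k : derivable (fun y => g y 0 k : R^o) z w by exact: ((derivable_mxP g z w).1 dg 0 k).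
pose h k : Z -> R^o := fun y => g y 0 k * F (delta_mx 0 k) y.
pose h' k : Z -> R^o := fun y => g z 0 k * F (delta_mx 0 k) y.
have E : \forall y \near z, (\sum_k h k) y = F (g y) y.
  by near=> y; rewrite fct_sumE /h -(linear_row_expansion (F := F^~ y))//; near: y; exact: lF.
have E' : \forall y \near z, (\sum_k h' k) y = F (g z) y.
  by near=> y; rewrite fct_sumE /h' -(linear_row_expansion (F := F^~ y))//; near: y; exact: lF.
have lz := nbhs_singleton lF.
have dh k : derivable (h k) z w by exact: derivableM.
have dh' k : derivable (h' k) z w.
  by apply: derivableM => //; exact: derivable_cst.
split; first exact: near_eq_derivable E (derivable_sum dh).
rewrite -(near_eq_derive _ E) -(near_eq_derive _ E') (derive_sum dh) (derive_sum dh').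
rewrite (linear_row_expansion _ lz) -big_split; apply: eq_bigr => k _ /=.
have -> : 'D_w (h' k) z = g z 0 k * 'D_w (F (delta_mx 0 k)) z.
  exact: deriveMl.
have -> : 'D_w (h k) z = g z 0 k * 'D_w (F (delta_mx 0 k)) z +
   F (delta_mx 0 k) z * 'D_w (fun y => g y 0 k : R^o) z.
  exact: deriveM.
by rewrite derive_mx// mxE [X in _ + X]mulrC.
Unshelve. all: by end_near. Qed.

End Pairing.

(** * Homogeneous energies and their Euler-Lagrange equations *)

Lemma addr_cancel (U : zmodType) (x y w d : U) :
  x - (y + w) + w = - d -> x = y - d.
Proof.
rewrite opprD addrA subrK.
by move/eqP; rewrite subr_eq addrC => /eqP.
Qed.

Lemma addr_eq_self (U : zmodType) (k d : U) : k = k + d -> d = 0.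
Proof. by move=> /esym/eqP; rewrite -subr_eq0 addrAC subrr add0r => /eqP. Qed.

Lemma deriveD_near (R : realType) (Z : normedModType R) (f1 f2 f : Z -> R^o) z w :
  derivable f1 z w -> derivable f2 z w ->
  (\forall y \near z, f1 y + f2 y = f y) ->
  'D_w f z = 'D_w f1 z + 'D_w f2 z.
Proof.
move=> d1 d2 E; rewrite -deriveD//; apply/esym/near_eq_derive.
exact: E.
Qed.

Section EulerLagrange.
Context (R : realType) (n : nat).
Let V := 'rV[R]_n.
Implicit Types (e : V * V -> R^o) (z : V * V).

Definition homogeneous2 e z := forall a (y : V), 0 <= a ->
  e (z.1, a *: y) = a ^+ 2 * e (z.1, y).

(** Along the ray through z the function is (1 + t) ^+ k * f z. *)
Lemma derive_euler_degree (f : V * V -> R^o) k z :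
  (forall a, 0 < a -> f (z.1, a *: z.2) = a ^+ k * f z) ->
  'D_(0, z.2) f z = k%:R * f z.
Proof.
move=> fk.
have H (h : R) : (z.1, h *: (1 : R^o) *: z.2 + z.2) = h *: (0, z.2) + (z.1, (0 : R^o) *: z.2 + z.2) :> V * V.
  by congr pair => /=; rewrite ?scaler0 ?add0r// scale0r add0r [h *: 1]mulr1.
have H' (h : R) : (z.1, (h *: (1 : R^o) + 0) *: z.2 + z.2) = h *: (0, z.2) + (z.1, (0 : R^o) *: z.2 + z.2) :> V * V.
  by rewrite addr0.
have [D _] := @derive_line _ _ _ _ f (fun t : R^o => (z.1, t *: z.2 + z.2)) (0 : R^o) 1 (0, z.2) H'.
move: D; rewrite scale0r add0r -surjective_pairing => <-.
have E : \forall t \near (0 : R^o), (fun t : R^o => (1 + t) ^+ k * f z : R^o) t =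
   (f \o (fun t : R^o => (z.1, t *: z.2 + z.2))) t.
  near=> t; rewrite /=.
  have -> : t *: z.2 + z.2 = (1 + t) *: z.2 by rewrite scalerDl scale1r addrC.
  rewrite fk//.
  have : `|t| < 1 by near: t; exact: (@nbhs0_lt R R^o).
  by rewrite ltr_norml => /andP[t1 _]; rewrite -ltrBlDl sub0r.
rewrite -(near_eq_derive _ E).
have d1 : is_derive (0 : R^o) (1 : R^o) ((cst 1 : R^o -> R^o) + id) (0 + 1).
  exact: is_deriveD.
have d2 := is_deriveX k d1.
have := @deriveMr _ _ (((cst 1 : R^o -> R^o) + id) ^+ k) (f z) 0 1 (@ex_derive _ _ _ _ _ _ _ d2).
rewrite (@derive_val _ _ _ _ _ _ _ d2).
have -> : f z \o* ((cst 1 : R^o -> R^o) + id) ^+ k =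
    (fun t : R^o => (1 + t) ^+ k * f z : R^o).
  by apply/funext => t; rewrite /= exprfctE.
move=> ->; rewrite -[(cst 1 + id) 0]/(1 + 0 : R) addr0 add0r expr1n mulr1.
by rewrite [_ *: 1]mulr1 mulrC.
Unshelve. all: by end_near. Qed.

Lemma derive_euler e z : homogeneous2 e z -> 'D_(0, z.2) e z = 2 * e z.
Proof.
move=> eh; apply: derive_euler_degree => a a0.
by rewrite eh ?ltW// -surjective_pairing.
Qed.

(** A vertical derivative of a 2-homogeneous function is 1-homogeneous. *)
Lemma derive_vertical_homogeneous e z a v : 0 < a -> homogeneous2 e z ->
  derivable e z (0, v) ->
  'D_(0, v) e (z.1, a *: z.2) = a * 'D_(0, v) e z.
Proof.
move=> a0 eh dv.
have an0 : a != 0 by rewrite gt_eqF.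
rewrite !derive_vertical /=.
have dv' : derivable (fun y => e (z.1, y)) z.2 v.
  have H h : (z.1, h *: v + z.2) = h *: (0, v) + (z.1, z.2) :> V * V.
    by congr pair => /=; rewrite scaler0 add0r.
  have [_ [_ D]] := derive_line (phi := fun y => (z.1, y)) e H.
  by apply: D; rewrite -surjective_pairing.
have H h : a^-1 *: (h *: v + a *: z.2) = h *: (a^-1 *: v) + a^-1 *: (a *: z.2).
  by rewrite scalerDr !scalerA mulrC.
have [D Dd] := derive_line (phi := fun y => a^-1 *: y) (fun y => e (z.1, y)) H.
have aK : a^-1 *: (a *: z.2) = z.2 by rewrite scalerA mulVf// scale1r.
rewrite aK in D Dd.
have [Da dva] := derive_direction_scale a^-1 dv'.
rewrite Da in D; have {Dd} dd := Dd.2 dva.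
have fE : (fun y => e (z.1, y)) =
   (fun y : V => a ^+ 2 *: ((fun y => e (z.1, y)) \o (fun y => a^-1 *: y)) y).
  apply/funext => y /=; rewrite -[LHS]/(e (z.1, y)).
  by rewrite -[in LHS](scale1r y) -(divff an0) -scalerA eh ?ltW.
rewrite [in LHS]fE deriveZ//= D.
rewrite -[LHS]/(a ^+ 2 * (a^-1 * 'D_v (fun y => e (z.1, y)) z.2)).
by rewrite mulrA expr2 mulfK.
Qed.

Lemma derive_euler_vertical e z v : smooth_near e z -> homogeneous2 e z ->
  'D_(0, z.2) ('D_(0, v) e) z = 'D_(0, v) e z.
Proof.
move=> es eh; rewrite (@derive_euler_degree _ 1) ?mul1r// => a a0.
by rewrite expr1; apply: derive_vertical_homogeneous => //; exact: smooth_near_derivable.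
Qed.

(** The equation of the spray, tested on vertical constant fields, says that
    g (G.1 - y, .) = 0; tested on horizontal ones it then becomes the Euler-Lagrange equation,
    because the vertical derivative of e along the frozen vector y is 2 e on the whole slice
    of constant y. *)
Lemma spray_euler_lagrange e z (G : V * V) (g : V * V -> V) :
  smooth_near e z ->
  (\forall y \near z, homogeneous2 e y) ->
  (forall v, v != 0 -> 'D_(0, v) ('D_(0, v) e) z != 0) ->
  g z = G.1 -> (forall w, derivable g z w) ->
  (forall a b : V,
     'D_G ('D_(0, a) e) z - 'D_(a, b) (fun y => 'D_(0, g y) e y) z
     + 'D_(0, 'D_(a, b) g z) e z = - 'D_(a, b) e z) ->
  G.1 = z.2 /\ forall a, 'D_G ('D_(0, a) e) z = 'D_(a, 0) e z.
Proof.
move=> es eh end_ gz dg EL.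
have es' := smooth_near_near es.
have fD := finite_dim_prod (finite_dim_rV R n) (finite_dim_rV R n).
have pE a b : 'D_(a, b) (fun y => 'D_(0, g y) e y) z =
    'D_(a, b) ('D_(0, G.1) e) z + 'D_(0, 'D_(a, b) g z) e z.
  rewrite -gz.
  have [||| _ H] := @derive_pairing R _ n (fun v => 'D_(0, v) e) g z (a, b);
    last exact: H.
  - by move=> v; exact/smooth_near_derivable/smooth_near_D.
  - exact: dg.
  near=> y => k v v'.
  have -> : (0, k *: v + v') = k *: (0, v) + (0, v') :> V * V.
    by congr pair; rewrite /= scaler0 addr0.
  have ey : smooth_near e y by near: y; exact: es'.
  exact: (derive_direction_linear _ _ _ (smooth_near_differentiableR fD ey)).
have {pE} EL' a b : 'D_G ('D_(0, a) e) z = 'D_(a, b) ('D_(0, G.1) e) z - 'D_(a, b) e z.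
  exact: addr_cancel (etrans (congr1 (fun t => _ - t + _) (esym (pE a b))) (EL a b)).
have ehz := nbhs_singleton eh.
have E1 v := derive_euler_vertical v es ehz.
have Gz : G.1 = z.2.
  apply/eqP; rewrite -subr_eq0; apply: contraT => /end_/eqP[].
  set b := G.1 - z.2.
  have D0 : 'D_(0, 0) e = (fun=> 0) by apply/funext => y; exact: derive0.
  have Hb : 'D_(0, b) ('D_(0, G.1) e) z = 'D_(0, b) e z.
    apply/eqP; rewrite -subr_eq0 -(EL' 0 b) D0; apply/eqP; exact: derive_cst.
  have E : \forall y \near z, 'D_(0, z.2) e y + 'D_(0, b) e y = 'D_(0, G.1) e y.
    near=> y; have ey : smooth_near e y by near: y; exact: es'.
    have -> : (0, G.1) = (0, z.2) + (0, b) :> V * V.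
      by congr pair; rewrite /= ?addr0// addrC subrK.
    by rewrite derive_direction_add.
  have := deriveD_near (smooth_near_derivable (0, b) (smooth_near_D (0, z.2) es))
                   (smooth_near_derivable (0, b) (smooth_near_D (0, b) es)) E.
  have S := derive_derive_sym (0, z.2) (0, b) es.
  move=> H; exact: addr_eq_self (etrans (esym Hb) (etrans H (congr1 (+%R^~ _) (etrans S (E1 b))))).
split; first exact: Gz.
move=> a; apply: etrans (EL' a 0) _; rewrite Gz.
have -> : 'D_(a, 0) ('D_(0, z.2) e) z = 2 * 'D_(a, 0) e z.
  rewrite !derive_horizontal.
  have E : \forall x \near z.1, (fun x => 2 *: (fun x => e (x, z.2)) x) x = 'D_(0, z.2) e (x, z.2).
    have N := near_slice eh.
    near=> x; apply/esym/(derive_euler (z := (x, z.2))).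
    by near: x; exact: N.
  rewrite -(near_eq_derive _ E).
  have dh : derivable (fun x => e (x, z.2)) z.1 a.
    have H h : (h *: a + z.1, z.2) = h *: (a, 0) + (z.1, z.2) :> V * V.
      by congr pair => /=; rewrite scaler0 add0r.
    have [_ [_ D]] := derive_line (phi := fun y => (y, z.2)) e H.
    by apply: D; rewrite -surjective_pairing; exact: smooth_near_derivable.
  exact: deriveZ.
by rewrite mulr2n mulrDl mul1r addrK.
Unshelve. all: by end_near. Qed.

End EulerLagrange.

(** * The energy and the metric in coordinates *)

Section LocalFinsler.
Context (R : realType) (n : nat) (M : manifold R n).
Let V := 'rV[R]_n.
Let A := matlas M.
Let AP : good_atlas A := manifold_atlas_good M.
Let T := TA M.
Let TP : good_atlas T := tangent_atlas_good M.

Definition localized (W : Type) (u : TM M) (f : TM M -> W) : V * V -> W :=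
  fun z => f (param T (chart_at T u) z).

Lemma in_chart_own (u : TM M) : slit u -> in_chart u (coord T u).
Proof. by move/near_in_chart/nbhs_singleton. Qed.

Lemma param_own (u : TM M) : param T (chart_at T u) (coord T u) = u.
Proof. by apply: (goodK TP); exact: (good_dom TP). Qed.

Lemma localized_own (W : Type) (u : TM M) (f : TM M -> W) :
  localized u f (coord T u) = f u.
Proof. by rewrite /localized param_own. Qed.

(** On a fibre the parametrisation is linear, which carries homogeneity and second derivatives
    along the fibre from L to its local expression. *)
Lemma param_fiber (u : TM M) z (y : V) : in_chart u z ->
  let p := param T (chart_at T u) z in
  param T (chart_at T u) (z.1, y) = (p.1, frame (chart_at A u.1) p.1 y).
Proof.
move=> [_ pd pz] p; rewrite paramTE; congr pair.
have {}pz : chart A (chart_at A u.1) (param A (chart_at A u.1) z.1) = z.1.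
  by rewrite -[RHS](congr1 fst pz).
by rewrite /frame /= pz.
Qed.

Lemma in_chart_snd u z : in_chart u z ->
  components (A := A) (chart_at A u.1) (param T (chart_at T u) z).1
    (param T (chart_at T u) z).2 = z.2.
Proof. by move=> [_ _ pz]; rewrite -[RHS](congr1 snd pz). Qed.

Lemma differential_near (f : TM M -> R^o) (h : V * V -> R^o) (u : TM M) w :
  (\forall z \near coord T u, localized u f z = h z) ->
  differential T f u w = 'D_w h (coord T u).
Proof. exact: near_eq_derive. Qed.

Section Finsler.
Context (L : TM M -> R) (FL : finsler L).

Lemma energy_smooth (u : TM M) : slit u ->
  smooth_near (localized u (energy L : TM M -> R^o)) (coord T u).
Proof.
move=> us; have Ls := finsler_smooth FL us.
have Ls2 := smooth_nearM Ls Ls.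
have := smooth_nearM Ls2 (smooth_near_cst (2^-1 : R^o) (coord T u)).
by apply: smooth_near_ext; near=> z; rewrite /localized /energy /= expr2.
Unshelve. all: by end_near. Qed.

Lemma energy_smooth_pt (u : TM M) z : in_chart u z ->
  fun_smooth_at T (energy L : TM M -> R^o) (param T (chart_at T u) z).
Proof. by move=> [ps _ _]; exact: energy_smooth. Qed.

Lemma energy_homogeneous (u : TM M) z : in_chart u z ->
  homogeneous2 (localized u (energy L : TM M -> R^o)) z.
Proof.
move=> zu a y a0; rewrite /localized !param_fiber// /energy.
have [_ pd _] := zu.
have fZ := frameZ AP a y pd.
set q := (param _ _ _).1 in fZ *.
have LE : L (q, frame (chart_at A u.1) q (a *: y)) = a * L (q, frame (chart_at A u.1) q y).
  apply: etrans (congr1 (fun t => L (_, t)) fZ) _.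
  exact: (finsler_homogeneous FL).
apply: etrans (congr1 (fun t => t ^+ 2 / 2) LE) _.
by rewrite exprMn; apply/esym/mulrA.
Qed.

Lemma finite_dim_VV : finite_dim (V * V : normedModType R)%type.
Proof. exact: finite_dim_prod (finite_dim_rV R n) (finite_dim_rV R n). Qed.

Lemma smooth_differentiable (f : V * V -> R^o) z :
  smooth_near f z -> differentiable f z.
Proof. exact: smooth_near_differentiableR finite_dim_VV. Qed.

Lemma differential_local (f : TM M -> R^o) (u : TM M) z w : in_chart u z ->
  fun_smooth_at T f (param T (chart_at T u) z) ->
  differential T f (param T (chart_at T u) z) w =
  'D_(components (A := T) (chart_at T u) (param T (chart_at T u) z) w) (localized u f) z.
Proof.
move=> [_ pd pz] fs; rewrite (differential_chart TP _ pd) ?pz//.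
exact: smooth_differentiable.
Qed.

(** Both sides are second derivatives along the fibre, and the fibre coordinates are linear
    functions of the tangent vector; 'D_v and the linear map are exchanged by [derive_line]. *)
Lemma metric_local (u : TM M) z v w : in_chart u z ->
  smooth_near (localized u (energy L : TM M -> R^o)) z ->
  let p := param T (chart_at T u) z in
  let c := components (A := A) (chart_at A u.1) p.1 in
  metric L p v w = 'D_(0, c v) ('D_(0, c w) (localized u (energy L : TM M -> R^o))) z.
Proof.
move=> zu es p c; set e := localized u _.
have [_ pd pz] := zu.
pose f := frame (chart_at A u.1) p.1.
have fP a x y : f (a *: x + y) = a *: f x + f y by exact: (frameP AP).
pose h (y : V) : R^o := L (p.1, y) ^+ 2.
have eE y : e (z.1, y) = h (f y) / 2 by rewrite /e /localized param_fiber.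
have Df (F : V -> R^o) x y : 'D_x F (f y) = 'D_(c x) (F \o f) y.
  have [-> _] := derive_line (phi := f) F (fun t => fP t (c x) y).
  have -> : f (c x) = x by exact: (componentsK AP).
  by [].
pose g (y : V) : R^o := e (z.1, y).
have dg (E : V * V -> R^o) y x : smooth_near E (z.1, y) ->
    derivable (fun y => E (z.1, y)) y x.
  move=> Ey; have H t : (z.1, t *: x + y) = t *: (0, x) + (z.1, y) :> V * V.
    by congr pair => /=; rewrite scaler0 add0r.
  have [_ [_ D]] := derive_line (phi := fun y => (z.1, y)) E H.
  by apply: D; exact: smooth_near_derivable.
have hf : h \o f = (2 \*o g).
  by apply/funext => y'; rewrite /= /g eE mulrC divfK.
have D1 y : smooth_near e (z.1, y) -> 'D_w h (f y) = 2 * 'D_(0, c w) e (z.1, y).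
  by move=> ey; rewrite Df hf deriveMl ?derive_vertical//; exact: dg.
have N : \forall y \near z.2, smooth_near e (z.1, y).
  exact: near_fibre (smooth_near_near es).
have p2 : p.2 = f z.2 by rewrite -(in_chart_snd zu); apply/esym/(componentsK AP).
rewrite /metric p2 -/h Df derive_vertical.
have E : \forall y \near z.2, (2 \*o (fun y => 'D_(0, c w) e (z.1, y))) y =
    ('D_w h \o f) y.
  by near=> y; rewrite /= D1//; near: y; exact: N.
rewrite -(near_eq_derive _ E) deriveMl; first by rewrite mulrC mulKf.
have sD : smooth_near ('D_(0, c w) e) (z.1, z.2).
  by rewrite -surjective_pairing; exact: smooth_near_D.
exact: dg sD.
Unshelve. all: by end_near. Qed.

Lemma metric_own (u : TM M) v w : slit u ->
  smooth_near (localized u (energy L : TM M -> R^o)) (coord T u) ->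
  metric L u v w =
  'D_(0, v) ('D_(0, w) (localized u (energy L : TM M -> R^o))) (coord T u).
Proof.
move=> us es; have := metric_local v w (in_chart_own us) es; cbv zeta.
rewrite param_own.
have cE (x : V) : components (A := A) (chart_at A u.1) u.1 x = x.
  exact: (components_own AP).
by rewrite !cE.
Qed.

End Finsler.
End LocalFinsler.

(** * The canonical spray in coordinates *)

Section Spray.
Context (R : realType) (n : nat) (M : manifold R n).
Let V := 'rV[R]_n.
Let A := matlas M.
Let T := TA M.
Let TP : good_atlas T := tangent_atlas_good M.

Definition coordinate_vfield (u : TM M) (w : V * V) : vfield M :=
  fun p => frame (A := T) (chart_at T u) p w.

Lemma coordinate_vfield_local (u : TM M) w z : in_chart u z ->
  vf_local (A := T) (chart_at T u) (coordinate_vfield u w) z = w.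
Proof. by move=> [_ pd pz]; exact: (frameK TP). Qed.

Lemma coordinate_vfield_smooth (u : TM M) w : slit u ->
  vf_smooth_at T (coordinate_vfield u w) u.
Proof.
move=> us; apply: smooth_near_ext (smooth_near_cst w (coord T u)).
have N := near_in_chart us.
by near=> z; rewrite coordinate_vfield_local//; near: z; exact: N.
Unshelve. all: by end_near. Qed.

Lemma coordinate_vfield_own (u : TM M) w : coordinate_vfield u w u = w.
Proof. exact: (frame_own TP). Qed.

Lemma vf_local_own (X : vfield M) u :
  vf_local (A := T) (chart_at T u) X (coord T u) = X u.
Proof. by rewrite /vf_local param_own; exact: (components_own TP). Qed.

Lemma vf_local_fst (X : vfield M) u z : in_chart u z ->
  (vf_local (A := T) (chart_at T u) X z).1 =
  components (A := A) (chart_at A u.1) (param T (chart_at T u) z).1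
    (X (param T (chart_at T u) z)).1.
Proof. by move=> [_ pd _]; exact: componentsT_fst. Qed.

Lemma dJ_own (f : TM M -> R) u w : d_J f u w = 'D_(0, w.1) (localized u (f : TM M -> R^o)) (coord T u).
Proof. by rewrite /d_J JE. Qed.

Section Finsler.
Context (L : TM M -> R) (FL : finsler L).

(** J only keeps the base part of a vector and makes it vertical, in any chart: so the 1-form
    d_J E on X is the derivative of E along the base components of X placed in the fibre. *)
Lemma dJ_local u z (X : vfield M) : in_chart u z ->
  d_J (energy L) (param T (chart_at T u) z) (X (param T (chart_at T u) z)) =
  'D_(0, (vf_local (A := T) (chart_at T u) X z).1) (localized u (energy L : TM M -> R^o)) z.
Proof.
move=> zu; have [_ pd _] := zu.
apply: etrans (differential_local _ zu (energy_smooth_pt FL zu)) _.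
apply: (congr1 (fun d => 'D_d _ z)).
rewrite JE; apply: etrans (componentsT_vertical _ pd) _.
by congr pair; exact/esym/vf_local_fst.
Qed.

(** Test the equation of the spray on the fields with constant coordinates (a, b); their
    bracket with G is the derivative of G along (a, b). *)
Lemma spray_local (G : vfield M) u : canonical_spray L G -> slit u ->
  (G u).1 = u.2 /\ forall a,
   'D_(G u) ('D_(0, a) (localized u (energy L : TM M -> R^o))) (coord T u) =
   'D_(a, 0) (localized u (energy L : TM M -> R^o)) (coord T u).
Proof.
move=> [Gs Geq] us; set e := localized u _; set c := coord T u.
have es : smooth_near e c := energy_smooth FL us.
have N := near_in_chart us.
have Gu : smooth_near (vf_local (A := T) (chart_at T u) G) c := Gs u us.
pose g z := (vf_local (A := T) (chart_at T u) G z).1.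
have c2 : u.2 = c.2 by rewrite /c coordTE.
have dg w : derivable g c w /\ 'D_w g c = ('D_w (vf_local (A := T) (chart_at T u) G) c).1.
  apply: (@derive_linear_comp _ _ _ _ (vf_local (A := T) (chart_at T u) G) fst c w).
    by move=> y; exact: cvg_fst.
  exact: smooth_near_derivable.
rewrite c2; apply: (@spray_euler_lagrange R n e c (G u) g es).
- by near=> z; apply: (energy_homogeneous FL); near: z; exact: N.
- move=> v v0; have vv := finsler_convex FL us v0.
  by rewrite (metric_own v v us es) in vv; exact: lt0r_neq0 vv.
- by rewrite /g vf_local_own.
- by move=> w; have [] := dg w.
move=> a b.
set X := coordinate_vfield u (a, b).
have Xu : X u = (a, b) by exact: coordinate_vfield_own.
have E1 : differential T (fun p => d_J (energy L) p (X p)) u (G u) =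
    'D_(G u) ('D_(0, a) e) c.
  apply: (@differential_near _ _ _ (fun p => d_J (energy L) p (X p)) ('D_(0, a) e) u (G u)).
  apply: filterS N => z zu; apply: etrans (dJ_local X zu) _.
  have Xz := congr1 fst (coordinate_vfield_local (a, b) zu).
  exact: (congr1 (fun d : V => 'D_(0, d) e z) Xz).
have E2 : differential T (fun p => d_J (energy L) p (G p)) u (X u) =
    'D_(a, b) (fun y => 'D_(0, g y) e y) c.
  rewrite Xu.
  apply: (@differential_near _ _ _ (fun p => d_J (energy L) p (G p))
    (fun y => 'D_(0, g y) e y) u (a, b)).
  by apply: filterS N => z zu; exact: dJ_local.
have E3 : lie_bracket T G X u = - 'D_(a, b) (vf_local (A := T) (chart_at T u) G) c.
  have D0 : 'D_(G u) (vf_local (A := T) (chart_at T u) X) c = 0.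
    apply: etrans (near_eq_derive (g := cst (a, b)) _ _) (derive_cst _ _ _).
    by apply: filterS N => z; exact: coordinate_vfield_local.
  apply: etrans (f_equal2 (fun x y => x - y) D0 _) (sub0r _).
  by rewrite Xu.
have E4 : d_J (energy L) u (lie_bracket T G X u) = - 'D_(0, 'D_(a, b) g c) e c.
  rewrite E3 dJ_own; have [_ ->] := dg (a, b).
  set d := 'D_(a, b) _ c.
  have -> : (0, (- d).1) = -1 *: (0, d.1) :> V * V.
    by congr pair; rewrite /= ?scaler0 ?scaleN1r.
  have [D _] := derive_direction_scale (-1) (smooth_near_derivable (0, d.1) es).
  by apply: etrans D _; rewrite scaleN1r.
have H0 := Geq u X us (coordinate_vfield_smooth (a, b) us).
have H1 : ext_deriv T (d_J (energy L)) G X u = _ :=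
  f_equal2 (fun x y => x - y) (f_equal2 (fun x y => x - y) E1 E2) E4.
rewrite opprK in H1; apply: etrans (esym H1) _; apply: etrans H0 _.
exact: (congr1 (fun w => - 'D_w e c) Xu).
Unshelve. all: by end_near. Qed.

End Finsler.
End Spray.

(** * Derivability of the inverse matrix *)

Section DerivableMatrix.
Context (R : realType) (Z : normedModType R).

Lemma derivable_prod (I : Type) (r : seq I) (P : pred I) (F : I -> Z -> R^o) z w :
  (forall i, derivable (F i) z w) ->
  derivable (fun y => \prod_(i <- r | P i) F i y : R^o) z w.
Proof.
move=> dF; elim: r => [|i r IH].
  under [X in derivable X]funext do rewrite big_nil.
  exact: derivable_cst.
case Pi: (P i).
  under [X in derivable X]funext do rewrite big_cons Pi.
  exact: (derivableM (dF i) IH).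
by under [X in derivable X]funext do rewrite big_cons Pi.
Qed.

Lemma derivable_big_sum (I : Type) (r : seq I) (P : pred I) (F : I -> Z -> R^o) z w :
  (forall i, derivable (F i) z w) ->
  derivable (fun y => \sum_(i <- r | P i) F i y : R^o) z w.
Proof.
move=> dF; elim: r => [|i r IH].
  under [X in derivable X]funext do rewrite big_nil.
  exact: derivable_cst.
case Pi: (P i).
  under [X in derivable X]funext do rewrite big_cons Pi.
  exact: (derivableD (dF i) IH).
by under [X in derivable X]funext do rewrite big_cons Pi.
Qed.

Lemma derivable_det n (K : Z -> 'M[R]_n) z w :
  (forall i j, derivable (fun y => K y i j : R^o) z w) ->
  derivable (fun y => \det (K y) : R^o) z w.
Proof.
move=> dK; rewrite /determinant; apply: derivable_big_sum => s.
by apply: derivableM; [exact: derivable_cst|apply: derivable_prod => i; exact: dK].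
Qed.

(** Cramer's rule. *)
Lemma derivable_invmx n (K : Z -> 'M[R]_n) z w :
  (forall i j, derivable (fun y => K y i j : R^o) z w) ->
  (\forall y \near z, K y \in unitmx) ->
  forall i j, derivable (fun y => invmx (K y) i j : R^o) z w.
Proof.
move=> dK uK i j.
have E : \forall y \near z, (\det (K y))^-1 * cofactor (K y) j i = invmx (K y) i j.
  by apply: filterS uK => y uy; rewrite /invmx uy !mxE.
apply: near_eq_derivable E _; apply: derivableM.
  apply: derivableV; last exact: derivable_det.
  by have := nbhs_singleton uK; rewrite unitmxE unitfE.
rewrite /cofactor; apply: derivableM; first exact: derivable_cst.
apply: derivable_det => k l.
by under [X in derivable X]funext do rewrite !mxE; exact: dK.
Qed.

End DerivableMatrix.

(** * Connections on the pulled back bundle are local *)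

Section Connection.
Context (R : realType) (n : nat) (M : manifold R n).
Let V := 'rV[R]_n.
Let A := matlas M.
Let AP : good_atlas A := manifold_atlas_good M.
Let T := TA M.

Definition pi_local (u : TM M) (xi : pi_vfield M) (z : V * V) : V :=
  let p := param T (chart_at T u) z in
  components (A := A) (chart_at A u.1) p.1 (xi p).

Definition coordinate_pi (u : TM M) (v : V) : pi_vfield M :=
  fun p => frame (A := A) (chart_at A u.1) p.1 v.

Lemma coordinate_pi_local (u : TM M) v z : in_chart u z ->
  pi_local u (coordinate_pi u v) z = v.
Proof. by move=> [_ pd pz]; exact: (frameK AP). Qed.

Lemma coordinate_pi_smooth (u : TM M) v : slit u -> pi_smooth_at (coordinate_pi u v) u.
Proof.
move=> us; apply: smooth_near_ext (smooth_near_cst v (coord T u)).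
by apply: filterS (near_in_chart us) => z zu; exact/esym/coordinate_pi_local.
Qed.

Lemma coordinate_pi_own (u : TM M) v : coordinate_pi u v u = v.
Proof. exact: (frame_own AP). Qed.

Lemma pi_local_own (u : TM M) xi : pi_local u xi (coord T u) = xi u.
Proof. by rewrite /pi_local param_own; exact: (components_own AP). Qed.

Lemma eta_local (u : TM M) z : in_chart u z -> pi_local u (@eta _ _ M) z = z.2.
Proof. exact: in_chart_snd. Qed.

Lemma eta_smooth (u : TM M) : slit u -> pi_smooth_at (@eta _ _ M) u.
Proof.
move=> us; apply: smooth_near_ext (smooth_near_snd (coord T u)).
by apply: filterS (near_in_chart us) => z zu; exact/esym/eta_local.
Qed.

Section Linear.
Context (D : covariant_derivative M) (DL : linear_connection D).

(** Multiply both sections by the function that is 1 where they agree and 0 elsewhere: it is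
    smooth near u with zero derivative, the products coincide, and the Leibniz rule gives
    back D on each section. *)
Lemma connection_germ (u : TM M) w xi psi : slit u ->
  pi_smooth_at xi u -> pi_smooth_at psi u ->
  (\forall z \near coord T u,
     xi (param T (chart_at T u) z) = psi (param T (chart_at T u) z)) ->
  D u w xi = D u w psi.
Proof.
move=> us xis psis E.
pose f (p : TM M) : R^o := if `[< xi p = psi p >] then 1 else 0.
have fE : \forall z \near coord T u, 1 = localized u f z.
  by apply: filterS E => z zE; rewrite /localized /f asboolT.
have fs : fun_smooth_at T f u.
  exact: smooth_near_ext fE (smooth_near_cst (1 : R^o) (coord T u)).
have fu : f u = 1.
  by have := nbhs_singleton fE; rewrite localized_own.
have df : differential T f u w = 0 :=
  etrans (esym (near_eq_derive w fE)) (derive_cst (1 : R^o) (coord T u) w).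
have H : (fun p => f p *: xi p) = (fun p => f p *: psi p).
  by apply/funext => p; rewrite /f; case: asboolP => [->//|_]; rewrite !scale0r.
have := connection_leibniz DL w us fs xis.
rewrite H (connection_leibniz DL w us fs psis) df fu !scale0r !add0r !scale1r.
by move=> ->.
Qed.

Lemma connection0 (u : TM M) w : slit u -> D u w (fun=> 0) = 0.
Proof.
move=> us.
have s0 : pi_smooth_at (fun=> 0 : V) u.
  apply: smooth_near_ext (smooth_near_cst (0 : V) (coord T u)).
  by apply: filterS (near_in_chart us) => z _; rewrite /components derive0.
have := connection_additive DL w us s0 s0.
rewrite addr0 => H.
have := addr_eq_self H.
by [].
Qed.

End Linear.

End Connection.

(** * Differentiability of the horizontal map *)

Lemma derivable_pair (R : realType) (U V W : normedModType R) (f : U -> V) (g : U -> W) x v :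
  derivable f x v -> derivable g x v -> derivable (fun z => (f z, g z)) x v.
Proof.
move=> /cvg_ex[a fa] /cvg_ex[b gb]; apply/cvg_ex; exists (a, b).
exact: (cvg_pair fa gb).
Qed.

Section Beta.
Context (R : realType) (n : nat) (M : manifold R n).
Let V := 'rV[R]_n.
Let A := matlas M.
Let AP : good_atlas A := manifold_atlas_good M.
Let T := TA M.
Let TP : good_atlas T := tangent_atlas_good M.
Context (D : covariant_derivative M) (DL : linear_connection D) (DR : regular D).

Definition connection_map_local (u : TM M) (w z : V * V) : V :=
  pi_local u (fun p => D p (coordinate_vfield u w p) (@eta _ _ M)) z.

Lemma connection_map_smooth u w : slit u -> smooth_near (connection_map_local u w) (coord T u).
Proof.
move=> us; exact: (connection_smooth DL us (coordinate_vfield_smooth w us) (eta_smooth us)).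
Qed.

Lemma connection_map_linear u z a w w' : in_chart u z ->
  connection_map_local u (a *: w + w') z = a *: connection_map_local u w z + connection_map_local u w' z.
Proof.
move=> [ps pd pz]; rewrite /connection_map_local /pi_local.
set p := param _ _ _ in ps pd *.
have H : coordinate_vfield u (a *: w + w') p =
    a *: coordinate_vfield u w p + coordinate_vfield u w' p.
  exact: (frameP TP).
have H' := connection_linear DL a (coordinate_vfield u w p) (coordinate_vfield u w' p) ps (eta_smooth ps).
apply: etrans (congr1 (fun x => components (chart_at A u.1) p.1 (D p x (@eta _ _ M))) H) _.
apply: etrans (congr1 (fun x => components (chart_at A u.1) p.1 x) H') _.
exact: (componentsP AP).
Qed.

(** Regularity splits (v, 0) into a vertical and a horizontal part; the latter is a lift of v. *)
Lemma beta_spec (p : TM M) v : slit p ->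
  D p (beta D p v) (@eta _ _ M) = 0 /\ (beta D p v).1 = v.
Proof.
move=> ps.
have [] : [set w | connection_map D p w = 0 /\ rho p w = v] (beta D p v).
  apply: xgetPex; have [_ /(_ (v, 0))[w1 [w2 [E r1 K2]]]] := DR ps.
  exists w2; split => //; move: r1; rewrite !rhoE => r1.
  by move/(congr1 fst): E; rewrite /= r1 add0r.
by rewrite rhoE.
Qed.

Lemma beta_local u xi z : in_chart u z ->
  let b := vf_local (A := T) (chart_at T u) (fun p => beta D p (xi p)) z in
  b.1 = pi_local u xi z /\ connection_map_local u b z = 0.
Proof.
move=> zu; have [ps pd pz] := zu; cbv zeta.
have [K0 b1] := beta_spec (xi (param T (chart_at T u) z)) ps.
split; first by rewrite (vf_local_fst _ zu) b1.
rewrite /connection_map_local /pi_local.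
set p := param _ _ _ in ps pd K0 b1 *.
have H : coordinate_vfield u (vf_local (A := T) (chart_at T u) (fun p => beta D p (xi p)) z) p =
    beta D p (xi p).
  exact: (componentsK TP).
apply: etrans (congr1 (fun x => components (chart_at A u.1) p.1 (D p x (@eta _ _ M))) H) _.
by rewrite K0 /components derive0.
Qed.

(** A vector that is both vertical and horizontal is zero, by regularity. *)
Lemma connection_map_vertical_inj u z b : in_chart u z -> connection_map_local u (0, b) z = 0 -> b = 0.
Proof.
move=> zu k0; have [ps pd pz] := zu.
set p := param T (chart_at T u) z in ps pd pz.
have K0 : D p (coordinate_vfield u (0, b) p) (@eta _ _ M) = 0.
  have := congr1 (frame (A := A) (chart_at A u.1) p.1) k0.
  rewrite /connection_map_local /pi_local (componentsK AP); last exact: pd.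
  by move=> ->; rewrite /frame derive0.
have H : coordinate_vfield u (0, b) p = (0, frame (A := A) (chart_at A u.1) p.1 b).
  have E := componentsT_vertical (frame (A := A) (chart_at A u.1) p.1 b) pd.
  rewrite (frameK AP) in E; last exact: pd.
  by rewrite -[LHS](congr1 (frame (A := T) (chart_at T u) p) E); exact: (componentsK TP).
have [inj _] := DR ps.
have r0 : rho p (coordinate_vfield u (0, b) p) = 0 by rewrite rhoE H.
have w0 := inj _ r0 K0.
have E : components (A := T) (chart_at T u) p (coordinate_vfield u (0, b) p) = (0, b) :=
  frameK TP pd (0, b).
have E0 : components (A := T) (chart_at T u) p 0 = 0 by exact: derive0.
have := etrans (esym E) (etrans (congr1 (components (A := T) (chart_at T u) p) w0) E0).
exact: (congr1 snd).
Qed.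

(** The matrix, acting on row vectors, of the connection map on vertical vectors. *)
Definition connection_mx (u : TM M) (z : V * V) : 'M[R]_n :=
  \matrix_(k, l) connection_map_local u (0, delta_mx 0 k) z 0 l.

Lemma connection_map_vertical u z b : in_chart u z -> connection_map_local u (0, b) z = b *m connection_mx u z.
Proof.
move=> zu.
have k0 : connection_map_local u (0, 0) z = 0.
  have := connection_map_linear (-1) (0, 0) (0, 0) zu.
  by rewrite scaler0 addr0 scaleN1r addNr.
have -> : connection_map_local u (0, b) z = \sum_k b 0 k *: connection_map_local u (0, delta_mx 0 k) z.
  rewrite {1}(row_sum_delta b).
  elim/big_rec2: _ => [|k t s _ <-]; first exact: k0.
  have W : (0, b 0 k *: delta_mx 0 k + s) = b 0 k *: (0, delta_mx 0 k) + (0, s) :> V * V.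
    by congr pair; rewrite /= scaler0 addr0.
  exact: (etrans (congr1 (fun w => connection_map_local u w z) W)
    (connection_map_linear (b 0 k) (0, delta_mx 0 k) (0, s) zu)).
apply/rowP => l; rewrite mxE summxE; apply: eq_bigr => k _.
by rewrite !mxE.
Qed.

Lemma connection_mx_unit u z : in_chart u z -> connection_mx u z \in unitmx.
Proof.
move=> zu; rewrite -row_free_unit; apply/row_freeP.
have /eqP : kermx (connection_mx u z) = 0.
  apply/row_matrixP => i; rewrite row0; apply: (connection_map_vertical_inj zu).
  rewrite connection_map_vertical// -row_mul mulmx_ker row0.
  by [].
by rewrite kermx_eq0 => /row_freeP.
Qed.

(** In coordinates the horizontal lift of a is (a, b), where b solves the linear system saying
    that the connection map vanishes on (a, b).  Its matrix [connection_mx] is invertible with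
    smooth entries, so b is derivable in every direction. *)
Lemma beta_derivable u xi w : slit u -> pi_smooth_at xi u ->
  derivable (vf_local (A := T) (chart_at T u) (fun p => beta D p (xi p))) (coord T u) w.
Proof.
move=> us xis; have N := near_in_chart us.
pose a := pi_local u xi.
pose h z := connection_map_local u (a z, 0) z.
have das : derivable a (coord T u) w by exact: smooth_near_derivable.
have dh l : derivable (fun z => h z 0 l : R^o) (coord T u) w.
  have [|||d _] := @derive_pairing R _ n (fun v z => connection_map_local u (v, 0) z 0 l : R^o) a (coord T u) w.
  - move=> v; apply: ((derivable_mxP _ _ _).1 _ 0 l).
    exact/smooth_near_derivable/connection_map_smooth.
  - exact: das.
  - apply: filterS N => z zu k v v'.
    have -> : (k *: v + v', 0) = k *: (v, 0) + (v', 0) :> V * V.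
      by congr pair; rewrite /= scaler0 addr0.
    have P := connection_map_linear k (v, 0) (v', 0) zu.
    by rewrite P !mxE.
  exact: d.
have dK i j : derivable (fun z => connection_mx u z i j : R^o) (coord T u) w.
  under [X in derivable X]funext do rewrite mxE.
  apply: ((derivable_mxP _ _ _).1 _ 0 j).
  exact/smooth_near_derivable/connection_map_smooth.
have uK : \forall z \near coord T u, connection_mx u z \in unitmx.
  by apply: filterS N => z; exact: connection_mx_unit.
have dI := derivable_invmx dK uK.
pose b z := - h z *m invmx (connection_mx u z).
have db : derivable b (coord T u) w.
  apply/derivable_mxP => i j; rewrite (ord1 i).
  under [X in derivable X]funext do rewrite mxE.
  apply: derivable_big_sum => k; apply: derivableM; last exact: dI.
  by under [X in derivable X]funext do rewrite mxE; exact: derivableN.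
have E : \forall z \near coord T u, (a z, b z) =
   vf_local (A := T) (chart_at T u) (fun p => beta D p (xi p)) z.
  apply: filterS N => z zu; have [] := beta_local xi zu.
  set B := vf_local _ _ _; case: B => B1 B2 /= -> kB; congr pair.
  have uz := connection_mx_unit zu.
  apply: (row_free_inj (A := connection_mx u z)).
    by rewrite row_free_unit.
  rewrite /b mulmxKV// -connection_map_vertical//.
  move: kB.
  have -> : (pi_local u xi z, B2) = 1 *: (pi_local u xi z, 0) + (0, B2) :> V * V.
    by congr pair; rewrite /= scale1r ?addr0 ?add0r.
  rewrite connection_map_linear// scale1r => /eqP; rewrite addr_eq0 => /eqP kE.
  by rewrite /h /a kE opprK.
exact: (near_eq_derivable E (derivable_pair das db)).
Qed.

End Beta.

(** * The torsions in coordinates *)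

Section Torsion.
Context (R : realType) (n : nat) (M : manifold R n).
Let V := 'rV[R]_n.
Let A := matlas M.
Let T := TA M.
Context (D : covariant_derivative M) (DL : linear_connection D) (DR : regular D).

Lemma pi_smooth_near (u : TM M) xi psi : pi_smooth_at xi u ->
  (\forall z \near coord T u,
     xi (param T (chart_at T u) z) = psi (param T (chart_at T u) z)) ->
  pi_smooth_at psi u.
Proof.
move=> xis E; apply: smooth_near_ext xis.
by apply: filterS E => z /= ->.
Qed.

Lemma rho_beta_near (u : TM M) psi : slit u ->
  \forall z \near coord T u,
    psi (param T (chart_at T u) z) =
    rho (param T (chart_at T u) z)
      (beta D (param T (chart_at T u) z) (psi (param T (chart_at T u) z))).
Proof.
move=> us; apply: filterS (near_in_chart us) => z [ps _ _].
by rewrite rhoE; have [_ ->] := beta_spec DR (psi (param T (chart_at T u) z)) ps.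
Qed.

(** The two sections agree only at nonzero vectors, where beta is a section of rho; locality of
    D makes this enough. *)
Lemma connection_rho_beta (u : TM M) w psi : slit u -> pi_smooth_at psi u ->
  D u w (fun p => rho p (beta D p (psi p))) = D u w psi.
Proof.
move=> us psis; have E := rho_beta_near psi us.
apply/esym; exact: (connection_germ DL w us psis (pi_smooth_near psis E) E).
Qed.

(** Derivability of the horizontal lift is indispensable here: it allows the derivative to be
    taken componentwise in the brackets of the torsion. *)
Lemma beta_local_derive (u : TM M) xi w : slit u -> pi_smooth_at xi u ->
  ('D_w (vf_local (A := T) (chart_at T u) (fun p => beta D p (xi p))) (coord T u)).1 =
  'D_w (pi_local u xi) (coord T u).
Proof.
move=> us xis; have dB := beta_derivable DL DR (w := w) us xis.
have cf : continuous (@fst V V) by move=> y; exact: cvg_fst.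
have [_ E] := derive_linear_comp cf dB.
apply: etrans (esym E) _; apply: near_eq_derive.
by apply: filterS (near_in_chart us) => z zu; have [] := beta_local DR xi zu.
Qed.

Lemma torsionQE (u : TM M) xi psi : slit u ->
  pi_smooth_at xi u -> pi_smooth_at psi u ->
  torsionQ D xi psi u =
  D u (beta D u (xi u)) psi - D u (beta D u (psi u)) xi
  - ('D_(beta D u (xi u)) (pi_local u psi) (coord T u)
     - 'D_(beta D u (psi u)) (pi_local u xi) (coord T u)).
Proof.
move=> us xis psis; rewrite /torsionQ /torsion.
rewrite (connection_rho_beta _ us xis) (connection_rho_beta _ us psis).
congr (_ - _); rewrite rhoE.
exact: (f_equal2 (fun x y => x - y) (beta_local_derive (beta D u (xi u)) us psis)
  (beta_local_derive (beta D u (psi u)) us xis)).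
Qed.

(** The bracket of a vertical constant field with the horizontal lift of psi projects to the
    vertical derivative of the components of psi. *)
Lemma torsionTE (u : TM M) v psi : slit u -> pi_smooth_at psi u ->
  torsionT D (coordinate_pi u v) psi u =
  D u (0, v) psi - 'D_(0, v) (pi_local u psi) (coord T u).
Proof.
move=> us psis; rewrite /torsionT /torsion.
rewrite (connection_rho_beta _ us psis).
have -> : (fun p => rho p (gamma p (coordinate_pi u v p))) = (fun=> 0).
  by apply/funext => p; rewrite gammaE rhoE.
rewrite (connection0 DL _ us) subr0 gammaE coordinate_pi_own.
congr (_ - _); rewrite rhoE.
set X := fun p => gamma p (coordinate_pi u v p).
have D0 w : 'D_w (vf_local (A := T) (chart_at T u) X) (coord T u) = 0.
  apply: etrans (near_eq_derive (g := cst (0, v)) _ _) (derive_cst _ _ _).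
  apply: filterS (near_in_chart us) => z zu; have [ps pd pz] := zu.
  rewrite /vf_local /X gammaE; apply: etrans (componentsT_vertical _ pd) _.
  by congr pair; exact: (coordinate_pi_local v zu).
have Xu : X u = (0, v) by rewrite /X gammaE coordinate_pi_own.
apply: etrans (f_equal2 (fun x y => x - y) (beta_local_derive (X u) us psis)
  (congr1 fst (D0 _))) _.
by rewrite Xu /= subr0.
Qed.

End Torsion.

(** * Algebra and smoothness of the Finsler metric *)

Section Metric.
Context (R : realType) (n : nat) (M : manifold R n).
Let V := 'rV[R]_n.
Let T := TA M.
Context (L : TM M -> R) (FL : finsler L).

Local Notation energy_at u := (localized u (energy L : TM M -> R^o)).

Lemma metricP (u : TM M) a v v' w : slit u ->
  metric L u (a *: v + v') w = a * metric L u v w + metric L u v' w.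
Proof.
move=> us; have es := energy_smooth FL us.
rewrite (metric_own (a *: v + v') w us es) (metric_own v w us es) (metric_own v' w us es).
have H : (0, a *: v + v') = a *: (0, v) + (0, v') :> V * V.
  by congr pair; rewrite /= scaler0 addr0.
apply: etrans (congr1 (fun d => 'D_d _ _) H) _.
apply: derive_direction_linear; apply: smooth_differentiable.
exact: smooth_near_D.
Qed.

Lemma metricC (u : TM M) v w : slit u -> metric L u v w = metric L u w v.
Proof.
move=> us; have es := energy_smooth FL us.
rewrite (metric_own v w us es) (metric_own w v us es).
exact: (derive_derive_sym _ _ es).
Qed.

Lemma metric0l (u : TM M) w : slit u -> metric L u 0 w = 0.
Proof.
move=> us; have := metricP (-1) 0 0 w us.
by rewrite scaler0 addr0 mulN1r addNr.
Qed.

Lemma metricZl (u : TM M) a v w : slit u -> metric L u (a *: v) w = a * metric L u v w.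
Proof. by move=> us; have := metricP a v 0 w us; rewrite metric0l// !addr0. Qed.

Lemma metricNl (u : TM M) v w : slit u -> metric L u (- v) w = - metric L u v w.
Proof. by move=> us; rewrite -scaleN1r metricZl// mulN1r. Qed.

Lemma metric_inj (u : TM M) v : slit u -> (forall w, metric L u v w = 0) -> v = 0.
Proof.
move=> us v0; apply/eqP; apply: contraT => vn0.
by have := finsler_convex FL us vn0; rewrite v0 ltxx.
Qed.

(** Euler's relation for the 1-homogeneous vertical derivatives of E. *)
Lemma metric_eta (u : TM M) v : slit u ->
  metric L u u.2 v = 'D_(0, v) (energy_at u) (coord T u).
Proof.
move=> us; have es := energy_smooth FL us.
rewrite (metric_own u.2 v us es).
have -> : u.2 = (coord T u).2 by rewrite coordTE.
exact: (derive_euler_vertical v es (energy_homogeneous FL (in_chart_own us))).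
Qed.

Lemma metric_eta_eta (u : TM M) : slit u -> metric L u u.2 u.2 = L u ^+ 2.
Proof.
move=> us; rewrite metric_eta//.
have E := derive_euler (energy_homogeneous FL (in_chart_own us)).
have -> : L u ^+ 2 = 2 * energy_at u (coord T u).
  by rewrite localized_own /energy mulrC divfK.
by rewrite -E coordTE.
Qed.

Lemma energy_near (u : TM M) : slit u ->
  \forall z \near coord T u, in_chart u z /\ smooth_near (energy_at u) z.
Proof.
move=> us; exact: filterI (near_in_chart us) (smooth_near_near (energy_smooth FL us)).
Qed.

Lemma metric_localized (u : TM M) xi psi z : in_chart u z ->
  smooth_near (energy_at u) z ->
  localized u (fun p => metric L p (xi p) (psi p)) z =
  'D_(0, pi_local u xi z) ('D_(0, pi_local u psi z) (energy_at u)) z.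
Proof. by move=> zu ez; exact: (metric_local _ _ zu ez). Qed.

(** Apply [smooth_near_pairing] once for each argument of the second fibre derivative of E. *)
Lemma metric_smooth (u : TM M) xi psi : slit u ->
  pi_smooth_at xi u -> pi_smooth_at psi u ->
  fun_smooth_at T (fun p => metric L p (xi p) (psi p) : R^o) u.
Proof.
move=> us xis psis; have es := energy_smooth FL us.
have lD (f : V * V -> R^o) y a v v' : smooth_near f y ->
    'D_(0, a *: v + v') f y = a * 'D_(0, v) f y + 'D_(0, v') f y.
  move=> fy; have H : (0, a *: v + v') = a *: (0, v) + (0, v') :> V * V.
    by congr pair; rewrite /= scaler0 addr0.
  apply: etrans (congr1 (fun d => 'D_d _ _) H) _.
  exact: (derive_direction_linear _ _ _ (smooth_differentiable fy)).
pose F w v (y : V * V) := 'D_(0, v) ('D_(0, w : V) (energy_at u)) y.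
have Fs w : smooth_near (fun y => F w (pi_local u xi y) y) (coord T u).
  have F1 v : smooth_near (F w v) (coord T u).
    exact: (smooth_near_D _ (smooth_near_D _ es)).
  apply: (smooth_near_pairing F1 xis).
  apply: filterS (smooth_near_near es) => y ey a v v'.
  exact: (lD _ _ _ _ _ (smooth_near_D _ ey)).
have S := smooth_near_pairing (F := fun w y => F w (pi_local u xi y) y) Fs psis.
apply: smooth_near_ext (S _); apply: filterS (energy_near us) => z [zu ez].
  exact/esym/(metric_localized xi psi zu ez).
move=> a v v'; rewrite /F.
have sym w := derive_derive_sym (0, w : V) (0, pi_local u xi z) ez.
apply: etrans (sym _) _; apply: etrans (lD _ _ a v v' (smooth_near_D _ ez)) _.
exact: (f_equal2 (fun x y => a * x + y) (esym (sym v)) (esym (sym v'))).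
Qed.

End Metric.

(** * Perturbing an energy by the square of a closed 1-form *)

Section Calculus.
Context (R : realType) (n : nat).
Let V := 'rV[R]_n.
Implicit Types (q e B et : V * V -> R^o) (b : V -> V * V -> R^o) (z : V * V).

(** Such a family b is, up to a factor, the horizontal part of the differential of q, whose
    vertical part is zero.  Both conclusions are symmetry of the second derivatives of q. *)
Lemma horizontal_gradient q b z : smooth_near q z ->
  (\forall y \near z, forall w : V * V, 'D_w q y = -2 * b w.1 y) ->
  (forall v w : V, 'D_(0, w) (b v) z = 0) /\
  (forall v w : V, 'D_(w, 0) (b v) z = 'D_(v, 0) (b w) z).
Proof.
move=> qs qb.
have n2 : (-2 : R) != 0 by rewrite oppr_eq0 pnatr_eq0.
have E v : \forall y \near z, ((-2)^-1 \*o 'D_(v, 0) q) y = b v y.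
  by apply: filterS qb => y yb /=; rewrite yb mulKf.
have Db v w : 'D_w (b v) z = (-2)^-1 * 'D_w ('D_(v, 0) q) z.
  apply: etrans (esym (near_eq_derive w (E v))) _.
  by apply: deriveMl; exact/smooth_near_derivable/smooth_near_D.
split=> v w.
  have E0 : \forall y \near z, cst (0 : R^o) y = 'D_(0, w) q y.
    apply: filterS qb => y yb; rewrite yb.
    by apply/esym; rewrite -[LHS](yb (0, 0)); exact: derive0.
  have D0 : 'D_(v, 0) ('D_(0, w) q) z = 0 :=
    etrans (esym (near_eq_derive (v, 0) E0)) (derive_cst (0 : R^o) z (v, 0)).
  have S := derive_derive_sym (v, 0) (0, w) qs.
  apply: etrans (Db v (0, w)) _.
  by apply: etrans (congr1 (fun t => _ * t) (etrans S D0)) _; rewrite mulr0.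
have S := derive_derive_sym (v, 0) (w, 0) qs.
apply: etrans (Db v (w, 0)) _; apply: etrans _ (esym (Db w (v, 0))).
exact: (congr1 (fun t => _ * t) S).
Qed.

Lemma half_double (x : R) : 2^-1 * (x + x) = x.
Proof. by field. Qed.

(** Needed because a neighbourhood on which infinitely many given functions are smooth need not
    exist; the finitely many basis vectors give one for the whole family. *)
Lemma smooth_near_linear_family b z :
  (forall k, smooth_near (b (delta_mx 0 k)) z) ->
  (\forall y \near z, forall a v v', b (a *: v + v') y = a * b v y + b v' y) ->
  forall v, smooth_near (b v) z.
Proof.
move=> bs bl v.
have S : smooth_near (fun y => \sum_k (fun k y => v 0 k * b (delta_mx 0 k) y : R^o) k y) z.
  apply: smooth_near_sum => k _.
  exact: (smooth_nearM (smooth_near_cst (v 0 k : R^o) z) (bs k)).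
apply: smooth_near_ext S; apply: filterS bl => y bly.
exact/esym/(linear_row_expansion (F := b^~ y)).
Qed.

(** As the coefficients b do not depend on the fibre, the function b_i y^i has vertical
    derivative b_v. *)
Lemma derive_vertical_tautological b z (v : V) :
  (forall w, smooth_near (b w) z) ->
  (\forall y \near z, forall a v v', b (a *: v + v') y = a * b v y + b v' y) ->
  (forall v w : V, 'D_(0, w) (b v) z = 0) ->
  'D_(0, v) (fun y => b y.2 y) z = b v z.
Proof.
move=> bs bl b0.
have [|||_ H] := @derive_pairing R _ n b snd z (0, v).
- by move=> w; exact: smooth_near_derivable.
- by exact/smooth_near_derivable/smooth_near_snd.
- exact: bl.
apply: etrans H _; rewrite b0 add0r.
congr (b _ z); exact: derive_of_linear.
Qed.

(** With B = b_i y^i the vertical derivative of et is that of e plus B b_v.  Differentiating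
    along Gt produces (Gt B) b_v + B (Gt b_v); as b is closed and constant on fibres, Gt b_v
    is the horizontal derivative of B along v, which the right hand side cancels. *)
Lemma perturbed_euler_lagrange e b z (G Gt : V * V) (et : V * V -> R^o) :
  smooth_near e z -> (forall v, smooth_near (b v) z) ->
  (\forall y \near z, forall a v v', b (a *: v + v') y = a * b v y + b v' y) ->
  (\forall y \near z, forall v w : V, 'D_(0, w) (b v) y = 0) ->
  (forall v w : V, 'D_(w, 0) (b v) z = 'D_(v, 0) (b w) z) ->
  (\forall y \near z, et y = e y + (b y.2 y) ^+ 2 / 2) ->
  G.1 = z.2 -> Gt.1 = z.2 ->
  (forall a, 'D_G ('D_(0, a) e) z = 'D_(a, 0) e z) ->
  (forall a, 'D_Gt ('D_(0, a) et) z = 'D_(a, 0) et z) ->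
  forall v, 'D_Gt ('D_(0, v) e) z + 'D_Gt (fun y => b y.2 y) z * b v z =
            'D_G ('D_(0, v) e) z.
Proof.
move=> es bs bl b0 bC etE G1 Gt1 EL ELt v.
pose B : V * V -> R^o := fun y => b y.2 y.
have Bs : smooth_near B z := smooth_near_pairing bs (smooth_near_snd z) bl.
have Det w y : smooth_near e y -> smooth_near B y ->
    (\forall t \near y, et t = e t + B t ^+ 2 / 2) ->
    'D_w et y = 'D_w e y + B y * 'D_w B y.
  move=> ey By E.
  have de := smooth_near_derivable w ey.
  have dB := smooth_near_derivable w By.
  have dBB : derivable (fun t => B t * B t : R^o) y w := derivableM dB dB.
  have E' : \forall t \near y, (e + (2^-1 \*o (fun t => B t * B t : R^o))) t = et t.
    by apply: filterS E => t ->; rewrite expr2 mulrC.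
  apply: etrans (esym (near_eq_derive w E')) _.
  have dh : derivable (2^-1 \*o (fun t => B t * B t : R^o)) y w.
    exact: (derivableM (derivable_cst (2^-1 : R^o) y w) dBB).
  apply: etrans (deriveD de dh) _; congr (_ + _).
  apply: etrans (deriveMl _ dBB) _.
  have -> : 'D_w (fun t => B t * B t : R^o) y = B y * 'D_w B y + B y * 'D_w B y := deriveM dB dB.
  exact: half_double.
have Vet : \forall y \near z, 'D_(0, v) e y + B y * b v y = 'D_(0, v) et y.
  have bsn : \forall y \near z, forall k : 'I_n, smooth_near (b (delta_mx 0 k)) y.
    have H (k : 'I_n) : \forall y \near z, smooth_near (b (delta_mx 0 k)) y.
      exact: (smooth_near_near (bs (delta_mx 0 k))).
    refine (@filter_forall _ _ (fun k y => smooth_near (b (delta_mx 0 k)) y) (nbhs z) _ H).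
  apply: filterS (filterI (filterI (smooth_near_near es) (smooth_near_near Bs))
    (filterI (filterI bsn (near_join bl)) (filterI b0 (near_join etE)))).
  move=> y [[ey By] [[bsy bly] [b0y etEy]]].
  apply/esym; apply: etrans (Det _ _ ey By etEy) _.
  congr (_ + _ * _).
  exact: (derive_vertical_tautological v (smooth_near_linear_family bsy bly) bly b0y).
have dDe w := smooth_near_derivable w (smooth_near_D (0, v) es).
have dB w := smooth_near_derivable w Bs.
have db w := smooth_near_derivable w (bs v).
have dBb w : derivable (fun y => B y * b v y : R^o) z w := derivableM (dB w) (db w).
have Dv w : 'D_w ('D_(0, v) et) z =
    'D_w ('D_(0, v) e) z + (B z * 'D_w (b v) z + b v z * 'D_w B z).
  apply: etrans (deriveD_near (dDe w) (dBb w) Vet) _; congr (_ + _).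
  exact: deriveM (dB w) (db w).
have Hv : 'D_(v, 0) et z = 'D_(v, 0) e z + B z * 'D_(v, 0) (b z.2) z.
  apply: etrans (Det (v, 0) z es Bs etE) _; congr (_ + _ * _).
  have [|||_ H] := @derive_pairing R _ n b snd z (v, 0).
  - by move=> w; exact: smooth_near_derivable.
  - by exact/smooth_near_derivable/smooth_near_snd.
  - exact: bl.
  apply: etrans H _.
  have -> : 'D_(v, 0) snd z = 0 by exact: derive_of_linear.
  have blz := nbhs_singleton bl.
  have -> : b 0 z = 0.
    by have := blz (-1) 0 0; rewrite scaler0 addr0 mulN1r addNr.
  by rewrite addr0.
have fD := finite_dim_prod (finite_dim_rV R n) (finite_dim_rV R n).
have GtE : 'D_Gt (b v) z = 'D_(v, 0) (b z.2) z.
  have H : Gt = 1 *: (z.2, 0) + (0, Gt.2) :> V * V.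
    by rewrite [LHS]surjective_pairing Gt1; congr pair; rewrite /= scale1r ?addr0 ?add0r.
  apply: etrans (congr1 (fun d => 'D_d (b v) z) H) _.
  apply: etrans (derive_direction_linear _ _ _ (smooth_near_differentiableR fD (bs v))) _.
  rewrite (nbhs_singleton b0) addr0 scale1r; exact: bC.
have := ELt v; rewrite (Dv Gt) Hv GtE EL.
move: ('D_Gt ('D_(0, v) e) z) ('D_(v, 0) e z) (B z * _) => x y t.
rewrite addrA => H.
have {}H : x + b v z * 'D_Gt B z + t = y + t by rewrite -H addrAC.
by rewrite [_ * b v z]mulrC; exact: (addIr t H).
Qed.

End Calculus.

(** * The canonical spray is horizontal for the Cartan connection *)

Lemma torsion_cancel (U : zmodType) (x y p q w : U) :
  x - y - (p - q) = 0 -> y = 0 -> p = 0 -> q = w -> x = - w.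
Proof.
move=> H y0 p0 qw; move: H; rewrite y0 p0 qw subr0 sub0r opprK => /eqP.
by rewrite addr_eq0 => /eqP.
Qed.

Section Cartan.
Context (R : realType) (n : nat) (M : manifold R n).
Let V := 'rV[R]_n.
Let T := TA M.
Context (L : TM M -> R) (FL : finsler L).
Context (D : covariant_derivative M) (HC : cartan_connection L D).

Local Notation energy_at u := (localized u (energy L : TM M -> R^o)).
Local Notation eta := (@eta R n M).

Let DL := cartan_linear HC.
Let DR := cartan_regular HC.

Lemma derive_coordinate_pi (u : TM M) v w : slit u ->
  'D_w (pi_local u (coordinate_pi u v)) (coord T u) = 0.
Proof.
move=> us; apply: etrans (near_eq_derive (g := cst v) _ _) (derive_cst _ _ _).
by apply: filterS (near_in_chart us) => z zu; exact: coordinate_pi_local.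
Qed.

Lemma derive_eta (u : TM M) w : slit u ->
  'D_w (pi_local u eta) (coord T u) = w.2.
Proof.
move=> us; apply: etrans (near_eq_derive (g := snd) _ _) (derive_of_linear _ _ _).
  by apply: filterS (near_in_chart us) => z zu; exact: eta_local.
by [].
Qed.

(** Q vanishes on eta and a coordinate field: differentiating the coordinate field radially is
    the same, up to the bracket, as differentiating eta, which is parallel along horizontal
    directions. *)
Lemma connection_radial (u : TM M) v : slit u ->
  D u (beta D u u.2) (coordinate_pi u v) = - (beta D u v).2.
Proof.
move=> us; have es := eta_smooth us; have cs := coordinate_pi_smooth v us.
set w := coordinate_pi u v u.
have [K0 _] := beta_spec DR w us.
have Q := etrans (esym (torsionQE DL DR us es cs)) (cartan_Q HC us es cs).
have Qv : D u (beta D u u.2) (coordinate_pi u v) = - (beta D u w).2.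
  exact: (torsion_cancel Q K0 (derive_coordinate_pi v (beta D u u.2) us)
    (derive_eta (beta D u w) us)).
by rewrite Qv /w coordinate_pi_own.
Qed.

(** E = g(eta, eta) / 2 and eta is parallel along horizontal vectors, so E is constant along
    them. *)
Lemma derive_energy_horizontal (u : TM M) v : slit u ->
  'D_(v, 0) (energy_at u) (coord T u) =
  - 'D_(0, (beta D u v).2) (energy_at u) (coord T u).
Proof.
move=> us; have es := energy_smooth FL us.
have [K0 b1] := beta_spec DR v us.
have cm := cartan_metric HC (beta D u v) us (eta_smooth us) (eta_smooth us).
have E : \forall z \near coord T u,
    localized u (fun p => metric L p (eta p) (eta p)) z = (2 \*o energy_at u) z.
  apply: filterS (near_in_chart us) => z [ps _ _].
  apply: etrans (metric_eta_eta FL ps) _.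
  by rewrite /= /localized /energy mulrC divfK.
have D2 : differential T (fun p => metric L p (eta p) (eta p)) u (beta D u v) =
    2 * 'D_(beta D u v) (energy_at u) (coord T u).
  apply: etrans (differential_near _ E) _.
  exact: (deriveMl _ (smooth_near_derivable _ es)).
rewrite K0 (metricC FL (eta u) 0 us) (metric0l FL _ us) addr0 in cm.
have {D2 cm E} D0 : 'D_(beta D u v) (energy_at u) (coord T u) = 0.
  have := etrans (esym D2) cm; move/eqP; rewrite mulf_eq0 pnatr_eq0 /=.
  by move/eqP.
have H : beta D u v = 1 *: (v, 0) + (0, (beta D u v).2) :> V * V.
  by rewrite [LHS]surjective_pairing b1; congr pair; rewrite /= scale1r ?addr0 ?add0r.
have L0 := derive_direction_linear 1 (v, 0) (0, (beta D u v).2) (smooth_differentiable es).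
have := etrans (esym L0) (etrans (congr1 (fun d => 'D_d (energy_at u) (coord T u)) (esym H)) D0).
rewrite scale1r => /eqP; rewrite addr_eq0 => /eqP.
exact.
Qed.

(** Compute the derivative of g(eta, d/dx^v) along the horizontal lift of eta by metric
    compatibility.  By [connection_radial] and [derive_energy_horizontal] it is the horizontal
    derivative of E along v; so the lift satisfies the Euler-Lagrange equations, which
    determine its vertical part. *)
Lemma spray_beta (G : vfield M) (u : TM M) : canonical_spray L G -> slit u ->
  G u = beta D u u.2.
Proof.
move=> GL us; have es := energy_smooth FL us.
have [G1 EL] := spray_local FL GL us.
have [K0 b1] := beta_spec DR u.2 us.
set b := beta D u u.2 in K0 b1 *.
have ELb v : 'D_b ('D_(0, v) (energy_at u)) (coord T u) = 'D_(v, 0) (energy_at u) (coord T u).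
  have E : \forall z \near coord T u,
    localized u (fun p => metric L p (eta p) (coordinate_pi u v p)) z =
    'D_(0, v) (energy_at u) z.
    apply: filterS (energy_near FL us) => z [zu ez].
    apply: etrans (metric_localized eta (coordinate_pi u v) zu ez) _.
    rewrite (eta_local zu) (coordinate_pi_local v zu).
    exact: (derive_euler_vertical v ez (energy_homogeneous FL zu)).
  have cm := cartan_metric HC b us (eta_smooth us) (coordinate_pi_smooth v us).
  apply: etrans (esym (differential_near b E)) _; apply: etrans cm _.
  rewrite K0 (metric0l FL _ us) add0r (connection_radial v us).
  rewrite (metricC FL _ _ us) (metricNl FL _ _ us) (metricC FL _ _ us).
  rewrite (metric_eta FL _ us); exact/esym/derive_energy_horizontal.
have H : G u = 1 *: b + (0, (G u).2 - b.2) :> V * V.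
  rewrite [LHS]surjective_pairing G1 -b1 [b in RHS]surjective_pairing; congr pair.
    by rewrite /= scale1r addr0.
  by rewrite /= scale1r addrC subrK.
have d0 : (G u).2 - b.2 = 0.
  apply: (metric_inj FL us) => v; rewrite (metric_own _ v us es).
  have dE := smooth_differentiable (smooth_near_D (0, v) es).
  have L0 := derive_direction_linear 1 b (0, (G u).2 - b.2) dE.
  have := etrans (congr1 (fun d => 'D_d ('D_(0, v) (energy_at u)) (coord T u)) H) L0.
  rewrite EL scale1r ELb; exact: addr_eq_self.
by rewrite H d0 scale1r addr0.
Qed.

End Cartan.

(** * Concurrent fields and the change of spray *)

Section Concurrent.
Context (R : realType) (n : nat) (M : manifold R n).
Let V := 'rV[R]_n.
Let A := matlas M.
Let AP : good_atlas A := manifold_atlas_good M.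
Let T := TA M.
Let TP : good_atlas T := tangent_atlas_good M.
Context (L : TM M -> R) (FL : finsler L).
Context (D : covariant_derivative M) (HC : cartan_connection L D).
Context (zeta : pi_vfield M) (HZ : concurrent D zeta).

Local Notation energy_at u := (localized u (energy L : TM M -> R^o)).
Local Notation eta := (@eta R n M).

Let DL := cartan_linear HC.
Let DR := cartan_regular HC.
Let zs := concurrent_smooth HZ.

Definition square_norm (p : TM M) : R^o := metric L p (zeta p) (zeta p).

(** The covariant components g(zeta, d/dx^v), as functions of the coordinates around u. *)
Definition lowered (u : TM M) (v : V) : V * V -> R^o :=
  localized u (fun p => metric L p (coordinate_pi u v p) (zeta p) : R^o).

Lemma square_norm_smooth (u : TM M) : slit u -> fun_smooth_at T square_norm u.
Proof. by move=> us; exact: (metric_smooth FL us (zs us) (zs us)). Qed.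

(** Split w into the horizontal lift of its base part and a vertical vector, and apply metric
    compatibility with nabla zeta = - id on the former and nabla zeta = 0 on the latter. *)
Lemma square_norm_differential (u : TM M) w : slit u ->
  differential T square_norm u w = -2 * metric L u w.1 (zeta u).
Proof.
move=> us; have ss := square_norm_smooth us.
have [K0 b1] := beta_spec DR w.1 us.
set b := beta D u w.1 in K0 b1.
have H : w = 1 *: b + (0, w.2 - b.2) :> V * V.
  rewrite [LHS]surjective_pairing [b in RHS]surjective_pairing b1; congr pair.
    by rewrite /= scale1r addr0.
  by rewrite /= scale1r addrC subrK.
have ch := cartan_metric HC b us (zs us) (zs us).
rewrite (concurrent_horizontal HZ _ us) (metricC FL (zeta u) _ us) (metricNl FL _ _ us) in ch.
have cv := cartan_metric HC (gamma u (w.2 - b.2)) us (zs us) (zs us).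
rewrite (concurrent_vertical HZ _ us) (metricC FL (zeta u) 0 us) (metric0l FL _ us) addr0 gammaE in cv.
(* ch and cv are the contributions of the horizontal and of the vertical part of w *)
have L0 := derive_direction_linear 1 b (0, w.2 - b.2) (smooth_differentiable ss).
apply: etrans (congr1 (fun d => 'D_d (localized u square_norm) (coord T u)) H) _.
apply: etrans L0 _.
apply: etrans (f_equal2 (fun x y => 1 * x + y) ch cv) _.
by rewrite mul1r addr0 -opprD -mulr2n mulNr mulr_natl.
Qed.

Lemma square_norm_derive (u : TM M) z w : in_chart u z ->
  'D_w (localized u square_norm) z = -2 * lowered u w.1 z.
Proof.
move=> zu; have [ps pd pz] := zu.
set p := param T (chart_at T u) z in ps pd pz.
have E := differential_local (coordinate_vfield u w p) zu (square_norm_smooth ps).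
have H : components (A := T) (chart_at T u) p (coordinate_vfield u w p) = w :=
  frameK TP pd w.
apply: etrans (congr1 (fun d => 'D_d (localized u square_norm) z) (esym H)) _.
apply: etrans (esym E) _; apply: etrans (square_norm_differential _ ps) _.
have H1 : (coordinate_vfield u w p).1 = coordinate_pi u w.1 p.
  have := vf_local_fst (coordinate_vfield u w) zu.
  rewrite (coordinate_vfield_local w zu) => ->.
  exact/esym/(componentsK AP).
exact: (congr1 (fun v => -2 * metric L p v (zeta p)) H1).
Qed.

Lemma lowered_smooth (u : TM M) v : slit u -> smooth_near (lowered u v) (coord T u).
Proof. by move=> us; exact: (metric_smooth FL us (coordinate_pi_smooth v us) (zs us)). Qed.

Lemma lowered_linear (u : TM M) z : in_chart u z ->
  forall a v v', lowered u (a *: v + v') z = a * lowered u v z + lowered u v' z.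
Proof.
move=> [ps pd pz] a v v'.
set p := param T (chart_at T u) z in ps pd pz.
have H : coordinate_pi u (a *: v + v') p = a *: coordinate_pi u v p + coordinate_pi u v' p.
  exact: (frameP AP).
apply: etrans (congr1 (fun x => metric L p x (zeta p)) H) _.
exact: (metricP FL _ _ _ _ ps).
Qed.

Lemma lowered_own (u : TM M) v : lowered u v (coord T u) = metric L u v (zeta u).
Proof. by rewrite /lowered localized_own coordinate_pi_own. Qed.

Lemma square_norm_near (u : TM M) : slit u ->
  \forall z \near coord T u, forall w : V * V,
   'D_w (localized u square_norm) z = -2 * lowered u w.1 z.
Proof.
move=> us; apply: filterS (near_in_chart us) => z zu w; exact: square_norm_derive.
Qed.

(** By [square_norm_derive] the covariant components of zeta are those of - d p2 / 2, and p2
    has no vertical derivative.  The first conclusion holds around u because it is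
    differentiated again in the Euler-Lagrange equations. *)
Lemma lowered_closed (u : TM M) : slit u ->
  (\forall z \near coord T u, forall v w : V, 'D_(0, w) (lowered u v) z = 0) /\
  (forall v w : V, 'D_(w, 0) (lowered u v) (coord T u) = 'D_(v, 0) (lowered u w) (coord T u)).
Proof.
move=> us; have ss := square_norm_smooth us; have N := square_norm_near us.
split; last by have [] := horizontal_gradient ss N.
apply: filterS (filterI (smooth_near_near ss) (near_join N)) => z [sz Nz].
by have [] := horizontal_gradient sz Nz.
Qed.

(** T(gamma v, zeta) is minus the vertical derivative of the components of zeta, since zeta is
    vertically parallel.  By the symmetry of T its product with w is g(T(gamma v, w), zeta),
    that is the vertical derivative of g(w, zeta), which is zero. *)
Lemma concurrent_vertically_constant (u : TM M) v : slit u ->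
  'D_(0, v) (pi_local u zeta) (coord T u) = 0.
Proof.
move=> us; apply: (metric_inj FL us) => w.
have cv := coordinate_pi_smooth v us; have cw := coordinate_pi_smooth w us.
have CT := cartan_T HC us cv (zs us) cw.
have T1 := torsionTE DL DR v us (zs us).
have T2 := etrans (torsionTE DL DR v us cw)
  (congr1 (fun x => D u (0, v) (coordinate_pi u w) - x) (derive_coordinate_pi w (0, v) us)).
rewrite T1 T2 subr0 coordinate_pi_own in CT.
have Dz : D u (0, v) zeta = 0.
  by have := concurrent_vertical HZ v us; rewrite gammaE.
rewrite Dz sub0r (metricNl FL _ _ us) in CT.
have cm := cartan_metric HC (0, v) us cw (zs us).
rewrite Dz (metricC FL _ 0 us) (metric0l FL _ us) addr0 in cm.
have b0 : 'D_(0, v) (lowered u w) (coord T u) = 0.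
  by have [b0 _] := lowered_closed us; exact: (nbhs_singleton b0).
have H := etrans CT (etrans (esym cm) b0).
by apply/eqP; rewrite -oppr_eq0; apply/eqP.
Qed.

Lemma lowered_eta (u : TM M) z : in_chart u z ->
  localized u (fun p => metric L p (zeta p) (eta p)) z = lowered u z.2 z.
Proof.
move=> zu; have [ps pd pz] := zu.
set p := param T (chart_at T u) z in ps pd pz.
have H : coordinate_pi u z.2 p = eta p.
  by rewrite -(in_chart_snd zu); exact: (componentsK AP).
apply: etrans (metricC FL _ _ ps) _.
exact: (congr1 (fun x => metric L p x (zeta p)) (esym H)).
Qed.

(** Metric compatibility along G = beta eta, where nabla zeta = - eta and nabla eta = 0. *)
Lemma derive_lowered_eta_spray (G : vfield M) (u : TM M) :
  canonical_spray L G -> slit u ->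
  'D_(G u) (fun z => lowered u z.2 z) (coord T u) = - L u ^+ 2.
Proof.
move=> GL us; rewrite (spray_beta FL HC GL us).
have E : \forall z \near coord T u,
    localized u (fun p => metric L p (zeta p) (eta p) : R^o) z = lowered u z.2 z.
  by apply: filterS (near_in_chart us) => z zu; exact: lowered_eta.
have cm := cartan_metric HC (beta D u u.2) us (zs us) (eta_smooth us).
have [K0 _] := beta_spec DR u.2 us.
rewrite K0 (concurrent_horizontal HZ _ us) (metricC FL (zeta u) 0 us) (metric0l FL _ us)
  addr0 (metricNl FL _ _ us) in cm.
apply: etrans (esym (differential_near _ E)) _; apply: etrans cm _.
by rewrite (metric_eta_eta FL us).
Qed.

Lemma square_norm_ge0 (u : TM M) : slit u -> 0 <= metric L u (zeta u) (zeta u).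
Proof.
move=> us; have [->|z0] := eqVneq (zeta u) 0; first by rewrite (metric0l FL _ us).
exact/ltW/(finsler_convex FL).
Qed.

(** Write d for the vertical difference of the sprays and tau for the derivative of B along Gt.
    The perturbed Euler-Lagrange equations give d = - tau zeta, while
    tau = - L^2 + g(d, zeta).  Eliminating d, - tau (1 + p2) = L^2. *)
Lemma spray_change (Lt : TM M -> R) (G Gt : vfield M) (u : TM M) :
  finsler Lt ->
  (forall u, slit u -> Lt u ^+ 2 = L u ^+ 2 + metric L u (zeta u) (eta u) ^+ 2) ->
  canonical_spray L G -> canonical_spray Lt Gt -> slit u ->
  Gt u = G u + (0, (L u ^+ 2 / (1 + metric L u (zeta u) (zeta u))) *: zeta u).
Proof.
move=> FLt LtE GL GtL us.
have es := energy_smooth FL us.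
have [G1 EL] := spray_local FL GL us.
have [Gt1 ELt] := spray_local FLt GtL us.
have bs v := lowered_smooth v us.
have bl : \forall z \near coord T u, forall a v v',
    lowered u (a *: v + v') z = a * lowered u v z + lowered u v' z.
  by apply: filterS (near_in_chart us) => z zu; exact: lowered_linear.
have [b0 bC] := lowered_closed us.
have etE : \forall z \near coord T u, localized u (energy Lt : TM M -> R^o) z =
    energy_at u z + (lowered u z.2 z) ^+ 2 / 2.
  apply: filterS (near_in_chart us) => z zu; have [ps _ _] := zu.
  rewrite -(lowered_eta zu) /localized /energy (LtE _ ps).
  by rewrite mulrDl.
have c2 : u.2 = (coord T u).2 by rewrite coordTE.
rewrite c2 in G1 Gt1.
have P := perturbed_euler_lagrange es bs bl b0 bC etE G1 Gt1 EL ELt.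
set d := (Gt u).2 - (G u).2.
have H : Gt u = 1 *: G u + (0, d) :> V * V.
  rewrite [LHS]surjective_pairing [G u in RHS]surjective_pairing G1 Gt1; congr pair.
    by rewrite /= scale1r addr0.
  by rewrite /= scale1r addrC subrK.
pose tau := 'D_(Gt u) (fun z => lowered u z.2 z) (coord T u).
have Bs := smooth_near_pairing bs (smooth_near_snd (coord T u)) bl.
have dir (f : V * V -> R^o) : smooth_near f (coord T u) ->
    'D_(Gt u) f (coord T u) = 'D_(G u) f (coord T u) + 'D_(0, d) f (coord T u).
  move=> fs; have L0 := derive_direction_linear 1 (G u) (0, d) (smooth_differentiable fs).
  apply: etrans (etrans (congr1 (fun x => 'D_x f (coord T u)) H) L0) _.
  by rewrite scale1r.
have tauE : tau = - L u ^+ 2 + metric L u d (zeta u).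
  apply: etrans (dir _ Bs) _.
  rewrite (derive_lowered_eta_spray GL us) -lowered_own; congr (_ + _).
  exact: (derive_vertical_tautological d bs bl (nbhs_singleton b0)).
have dz v : metric L u d v = - tau * metric L u (zeta u) v.
  have Pv := P v.
  have D1 := dir _ (smooth_near_D (0, v) es).
  rewrite (metric_own d v us es) (metricC FL _ _ us) -lowered_own mulNr.
  rewrite D1 -addrA -/tau in Pv.
  have := addr_eq_self (esym Pv) => /eqP; rewrite addr_eq0 => /eqP.
  exact.
have dE : d = (- tau) *: zeta u.
  apply/eqP; rewrite -subr_eq0; apply/eqP/(metric_inj FL us) => v.
  have := metricP FL (-1) (- tau *: zeta u) d v us.
  rewrite scaleN1r addrC => ->.
  by rewrite dz (metricZl FL _ _ _ us) mulN1r addNr.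
have p0 : 1 + metric L u (zeta u) (zeta u) != 0.
  by apply: lt0r_neq0; apply: ltr_wpDr; [exact: square_norm_ge0|].
have tauV : - tau = L u ^+ 2 / (1 + metric L u (zeta u) (zeta u)).
  apply: (mulIf p0); rewrite divfK// mulrDr mulr1.
  rewrite dE (metricZl FL _ _ _ us) in tauE.
  by rewrite {1}tauE opprD opprK mulNr opprK addrK.
by rewrite -tauV -dE H scale1r.
Qed.

End Concurrent.

(** * The change of the Barthel connection *)

Section Scaling.
Context (R : realType).

Lemma derive_scale_field (Z : normedModType R) n (f : Z -> R^o) (g : Z -> 'rV[R]_n) z w :
  derivable f z w -> derivable g z w ->
  derivable (fun y => (f y : R) *: g y) z w /\
  'D_w (fun y => (f y : R) *: g y) z = (f z : R) *: 'D_w g z + ('D_w f z : R) *: g z.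
Proof.
move=> df dg.
have dgk k : derivable (fun y => g y 0 k : R^o) z w.
  exact: ((derivable_mxP g z w).1 dg 0 k).
have dfg k : derivable (fun y => f y * g y 0 k : R^o) z w := derivableM df (dgk k).
have d : derivable (fun y => (f y : R) *: g y) z w.
  apply: (derivable_mxP _ _ _).2 => i k; rewrite (ord1 i).
  by under [X in derivable X]funext do rewrite mxE; exact: dfg.
split; first exact: d.
apply/rowP => k; rewrite (derive_mx d) !mxE.
have -> : (fun y => ((f y : R) *: g y) 0 k) = (fun y => f y * g y 0 k).
  by apply/funext => y; rewrite mxE.
rewrite (derive_mx dg) mxE [X in _ + X]mulrC.
exact: deriveM df (dgk k).
Qed.

Lemma derivable_quotient (Z : normedModType R) (f g : Z -> R^o) z w :
  derivable f z w -> derivable g z w -> g z != 0 ->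
  derivable (fun y => f y / g y : R^o) z w.
Proof.
move=> df dg g0; exact: (derivableM df (derivableV g0 dg)).
Qed.

(** A denominator that is stationary in the direction w behaves as a constant. *)
Lemma derive_quotient (Z : normedModType R) (f g : Z -> R^o) z w :
  derivable f z w -> derivable g z w -> g z != 0 -> 'D_w g z = 0 ->
  'D_w (fun y => f y / g y : R^o) z = 'D_w f z / g z.
Proof.
move=> df dg g0 Dg.
have dV : derivable (fun y => (g y)^-1 : R^o) z w by exact: derivableV.
have H : 'D_w (fun y => f y / g y : R^o) z =
    f z * 'D_w (fun y => (g y)^-1 : R^o) z + (g z)^-1 * 'D_w f z := deriveM df dV.
rewrite H; have -> : 'D_w (fun y => (g y)^-1 : R^o) z = 0.
  by apply: etrans (deriveV g0 dg) _; rewrite Dg scaler0.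
by rewrite mulr0 add0r mulrC.
Qed.

End Scaling.

Lemma vertical_change (U : zmodType) (a a' b b' : U * U) (f f' : U) :
  a' = a + (0, f) -> b' = b + (0, f') ->
  a' - (0, b'.1) = a - (0, b.1) + (0, f).
Proof. by move=> -> ->; rewrite /= addr0 addrAC. Qed.

Section Barthel.
Context (R : realType) (n : nat) (M : manifold R n).
Let V := 'rV[R]_n.
Let A := matlas M.
Let T := TA M.

Local Notation vf_at u X := (vf_local (A := T) (chart_at T u) X).

Lemma derive_J (F : V * V -> V * V) z w : derivable F z w ->
  'D_w (fun y => (0, (F y).1) : V * V) z = (0, ('D_w F z).1).
Proof.
move=> dF; pose j (w : V * V) : V * V := (0, w.1).
have jl : linear j by move=> a x y; rewrite /j; congr pair; rewrite /= scaler0 addr0.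
pose jL : {linear (V * V)%type -> (V * V)%type} :=
  HB.pack j (GRing.isLinear.Build _ _ _ _ _ jl).
have jc : continuous jL.
  move=> y; apply: differentiable_continuous.
  exact: (differentiable_pair (differentiable_cst _ _) (differentiable_fst _)).
by have [_ E] := derive_linear_comp jc dF.
Qed.

Lemma derive_inject (g : V * V -> V) z w : derivable g z w ->
  derivable (fun y => (0, g y) : V * V) z w /\
  'D_w (fun y => (0, g y) : V * V) z = (0, 'D_w g z).
Proof.
move=> dg; pose j (v : V) : V * V := (0, v).
have jl : linear j by move=> a x y; rewrite /j; congr pair; rewrite /= scaler0 addr0.
pose jL : {linear V -> (V * V)%type} :=
  HB.pack j (GRing.isLinear.Build _ _ _ _ _ jl).
have jc : continuous jL.
  move=> y; apply: differentiable_continuous.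
  have dy : differentiable (@id V) y by [].
  exact: (differentiable_pair (differentiable_cst (0 : V) y) dy).
exact: (derive_linear_comp jc dg).
Qed.

(** The derivatives of X along G occur in both brackets and cancel, because J is constant in
    coordinates. *)
Lemma bracketJ_local (G X : vfield M) (u : TM M) : slit u -> vf_smooth_at T X u ->
  bracketJ G X u =
  'D_(0, (X u).1) (vf_at u G) (coord T u) - (0, ('D_(X u) (vf_at u G) (coord T u)).1).
Proof.
move=> us Xs.
have E : 'D_(G u) (vf_at u (fun p => J p (X p))) (coord T u) =
    (0, ('D_(G u) (vf_at u X) (coord T u)).1).
  have N : \forall z \near coord T u,
      vf_at u (fun p => J p (X p)) z = (0, (vf_at u X z).1).
    apply: filterS (near_in_chart us) => z zu; have [ps pd pz] := zu.
    rewrite (vf_local_fst X zu) /vf_local JE.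
    exact: (componentsT_vertical _ pd).
  exact: (etrans (near_eq_derive _ N) (derive_J (smooth_near_derivable (G u) Xs))).
rewrite /bracketJ JE.
apply: etrans (f_equal2 (fun x y => x - y - _) (congr1 (fun d => 'D_d _ _) (JE u (X u))) E) _.
rewrite -addrA -opprD; congr (_ - _); rewrite [LHS]surjective_pairing; congr pair.
  by rewrite /= addr0.
by rewrite /= addrC subrK.
Qed.

End Barthel.

Theorem theorem4p6 (R : realType) (n : nat) (M : manifold R n)
    (L : TM M -> R) (nabla : covariant_derivative M) (zeta : pi_vfield M)
    (Lt : TM M -> R) (Gam Gamt : vfield M -> vfield M) :
  finsler L ->
  cartan_connection L nabla ->
  concurrent nabla zeta ->
  finsler Lt ->
  (forall u : TM M, slit u ->
     Lt u ^+ 2 = L u ^+ 2 + metric L u (zeta u) (eta u) ^+ 2) ->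
  barthel_connection L Gam ->
  barthel_connection Lt Gamt ->
  forall (X : vfield M) (u : TM M), slit u -> vf_smooth_at (TA M) X u ->
    Gamt X u =
    Gam X u +
    2 *: form_tensor
           (fun u' w => d_J (energy L) u' w / (1 + metric L u' (zeta u') (zeta u')))
           (fun u' => gamma u' (zeta u')) X u.
Proof.
move=> FL HC HZ FLt LtE [G GL GamE] [Gt GtL GamtE] X u us Xs.
rewrite (GamtE X u us Xs) (GamE X u us Xs) !bracketJ_local//.
set c := coord (TA M) u; set i := chart_at (TA M) u.
pose V := 'rV[R]_n.
pose lam (p : TM M) : R^o := L p ^+ 2 / (1 + metric L p (zeta p) (zeta p)).
pose laml := localized u lam.
pose zl := pi_local u zeta.
pose x := (X u).1.
have es := energy_smooth FL us.
have ss : smooth_near (localized u (square_norm L zeta)) c := square_norm_smooth FL HZ us.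
have den0 : 1 + localized u (square_norm L zeta) c != 0.
  rewrite localized_own; apply: lt0r_neq0; apply: ltr_wpDr; last exact: ltr01.
  exact: (square_norm_ge0 FL zeta us).
(* the factor of gamma zeta, as a quotient whose denominator is constant on fibres *)
pose num : _ -> R^o := fun z => 2 * localized u (energy L : TM M -> R^o) z.
pose den : _ -> R^o := fun z => 1 + localized u (square_norm L zeta) z.
have dden w : derivable den c w.
  exact: (derivableD (derivable_cst (1 : R^o) c w) (smooth_near_derivable w ss)).
have dnum w : derivable num c w.
  exact: (derivableM (derivable_cst (2 : R^o) c w) (smooth_near_derivable w es)).
have lamE : laml = (fun z => num z / den z : R^o).
  apply/funext => z; rewrite /num /den /laml /lam /localized /energy.
  by rewrite mulrCA divff ?mulr1// pnatr_eq0.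
have dc0 : den c != 0 := den0.
have dlam w : derivable laml c w.
  by rewrite lamE; exact: derivable_quotient.
have dz w : derivable zl c w := smooth_near_derivable w (concurrent_smooth HZ us).
(* the differential of p2 only sees the base part of a vector, here 0 *)
have s0 : 'D_(0, x) (localized u (square_norm L zeta)) c = 0.
  have zu := in_chart_own us.
  rewrite (square_norm_derive FL HC HZ (0, x) zu).
  rewrite -[RHS](derive0 (localized u (square_norm L zeta)) c).
  by rewrite -[LHS](square_norm_derive FL HC HZ (0, 0) zu).
have Dlam : 'D_(0, x) laml c =
    2 * d_J (energy L) u (X u) / (1 + metric L u (zeta u) (zeta u)).
  have Dden : 'D_(0, x) den c = 0.
    apply: etrans (deriveD (derivable_cst (1 : R^o) c (0, x)) (smooth_near_derivable (0, x) ss)) _.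
    by rewrite s0 addr0; exact: derive_cst.
  have Dnum : 'D_(0, x) num c = 2 * d_J (energy L) u (X u).
    rewrite dJ_own; exact: (deriveMl 2 (smooth_near_derivable (0, x) es)).
  rewrite lamE (derive_quotient (dnum _) (dden _) dc0 Dden) Dnum.
  by rewrite /den localized_own.
pose f z := (laml z : R) *: zl z.
have df w : derivable f c w := (derive_scale_field (dlam w) (dz w)).1.
have GtlE : \forall z \near c,
    vf_local (A := TA M) i G z + (0, f z) = vf_local (A := TA M) i Gt z.
  apply: filterS (near_in_chart us) => z [ps pd pz].
  have H := spray_change FL HC HZ FLt LtE GL GtL ps.
  apply/esym.
  apply: etrans (congr1 (components (A := TA M) i (param (TA M) i z)) H) _.
  apply: etrans (componentsD (tangent_atlas_good M) _ _ pd) _.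
  congr (_ + _); apply: etrans (componentsT_vertical _ pd) _.
  by congr pair; exact: (componentsZ (manifold_atlas_good M) _ _ pd).
have DGt w : 'D_w (vf_local (A := TA M) i Gt) c =
    'D_w (vf_local (A := TA M) i G) c + (0, 'D_w f c).
  have [dj Dj] := derive_inject (df w).
  have dG := smooth_near_derivable w (spray_smooth GL us).
  apply: etrans (esym (near_eq_derive w GtlE)) _.
  apply: etrans (deriveD dG dj) _.
  exact: (congr1 (fun t => _ + t) Dj).
have Df : 'D_(0, x) f c =
    (2 * d_J (energy L) u (X u) / (1 + metric L u (zeta u) (zeta u))) *: zeta u.
  have [_ H] := derive_scale_field (dlam (0, x)) (dz (0, x)).
  have z0 : 'D_(0, x) zl c = 0 := concurrent_vertically_constant FL HC HZ x us.
  have zc : zl c = zeta u := pi_local_own u zeta.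
  apply: etrans (etrans H (f_equal2 (fun a b => (laml c : R) *: a + b) z0
    (f_equal2 (fun (a : R) b => a *: b) Dlam zc))) _.
  exact: (etrans (congr1 (+%R^~ _) (scaler0 _ _)) (add0r _)).
apply: etrans (vertical_change (DGt (0, x)) (DGt (X u))) _.
congr (_ + _); apply: etrans (congr1 (pair 0) Df) _.
rewrite /form_tensor gammaE; congr pair; first by rewrite /= !scaler0.
by rewrite /= scalerA mulrA.
Qed.
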